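(* For every $K\geq 0$ there is a constant $C=C(K)$ depending only on $K$ such that the following holds. Let $X$ be a finite $K$-approximate subring of a ring $R$. There exist a subring $R'\subseteq R$ and an ideal $I$ of $R'$ such that: \begin{enumerate} \item $X$ is covered by at most $C$ additive cosets of $R'$; \item $I\subseteq X_3$; \item $R'/I$ is nilpotent of class at most $C$. \end{enumerate}
   Context: Rings are associative but not necessarily commutative or unital; ideals are two-sided. For subsets $Y,Z$ of a ring, $Y+Z=\{y+z\}$ and $Y\cdot Z=\{yz\}$ ($y\in Y$, $z\in Z$). A subset $X$ of a ring $R$ is a $K$-approximate subring if it is additively symmetric ($0\in X$ and $X=-X$) and $(X\cdot X)\cup(X+X)$ is covered by $K$ additive translates of $X$. Define recursively $X_0=X$ and $X_{n+1}=X_n+X_n+X_n\cdot X_n$. A ring $S$ is nilpotent of class at most $n$ if every product of $n+1$ elements of $S$ is $0$ (class at most $0$ means $S=\{0\}$). *)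

(* Defs.v *)
From HB Require Import structures.
From mathcomp Require Import all_boot all_order all_algebra ring_quotient generic_quotient.
From mathcomp Require Import boolp classical_sets functions cardinality.

Set Implicit Arguments.
Unset Strict Implicit.
Unset Printing Implicit Defensive.

Import GRing.Theory.

Local Open Scope classical_set_scope.
Local Open Scope ring_scope.
Local Open Scope quotient_scope.

Reserved Notation "x ** y" (at level 40, left associativity).

(* MathComp rings are all unital; [rngType] is the structure of associative
   rings that need be neither commutative nor unital. *)
HB.mixin Record isRng R of GRing.Zmodule R := {
  rmul : R -> R -> R;
  rmulA : associative rmul;
  rmulDl : left_distributive rmul +%R;
  rmulDr : right_distributive rmul +%R
}.

#[short(type="rngType")]
HB.structure Definition Rng := {R of isRng R & GRing.Zmodule R}.

Notation "x ** y" := (rmul x y) : ring_scope.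

Section RngTheory.
Variable R : rngType.
Implicit Types x y z : R.

Lemma rmul0r x : 0 ** x = 0.
Proof. by apply: (addrI (0 ** x)); rewrite -rmulDl !addr0. Qed.

Lemma rmulr0 x : x ** 0 = 0.
Proof. by apply: (addrI (x ** 0)); rewrite -rmulDr !addr0. Qed.

Lemma rmulNl x y : (- x) ** y = - (x ** y).
Proof. by apply: (addrI (x ** y)); rewrite -rmulDl !subrr rmul0r. Qed.

Lemma rmulNr x y : x ** (- y) = - (x ** y).
Proof. by apply: (addrI (x ** y)); rewrite -rmulDr !subrr rmulr0. Qed.

Lemma rmulBl x y z : (x - y) ** z = x ** z - y ** z.
Proof. by rewrite rmulDl rmulNl. Qed.

Lemma rmulBr x y z : x ** (y - z) = x ** y - x ** z.
Proof. by rewrite rmulDr rmulNr. Qed.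

End RngTheory.

HB.mixin Record isRmulClosed (R : rngType) (S : R -> bool) := {
  rmul_closed_subproof : {in S &, forall x y, x ** y \in S}
}.

#[short(type="subrng")]
HB.structure Definition Subrng (R : rngType) :=
  {S of GRing.ZmodClosed R S & isRmulClosed R S}.

HB.mixin Record isRmulAbsorbing (R : rngType) (I : R -> bool) := {
  rmul_absorbing_subproof :
    forall a x : R, x \in I -> (a ** x \in I) /\ (x ** a \in I)
}.

#[short(type="rngIdeal")]
HB.structure Definition RngIdeal (R : rngType) :=
  {I of GRing.ZmodClosed R I & isRmulAbsorbing R I}.

Section Closure.
Variable R : rngType.

Lemma subrngM (S : subrng R) x y :
  x \in (S : {pred R}) -> y \in (S : {pred R}) -> x ** y \in (S : {pred R}).
Proof. exact: rmul_closed_subproof. Qed.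

Lemma rngIdealMl (I : rngIdeal R) a x :
  x \in (I : {pred R}) -> a ** x \in (I : {pred R}).
Proof. by move=> Ix; have [] := rmul_absorbing_subproof a x Ix. Qed.

Lemma rngIdealMr (I : rngIdeal R) a x :
  x \in (I : {pred R}) -> x ** a \in (I : {pred R}).
Proof. by move=> Ix; have [] := rmul_absorbing_subproof a x Ix. Qed.

End Closure.

Section SubrngType.
Variables (R : rngType) (S : subrng R).

Record subrng_type := SubrngElt {
  subrng_val : R;
  subrng_valP : subrng_val \in (S : {pred R})
}.

HB.instance Definition _ := [isSub for subrng_val].
HB.instance Definition _ := [Choice of subrng_type by <:].
HB.instance Definition _ := [SubChoice_isSubZmodule of subrng_type by <:].

Definition subrng_mul (x y : subrng_type) : subrng_type :=
  SubrngElt (subrngM (subrng_valP x) (subrng_valP y)).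

Lemma subrng_mulA : associative subrng_mul.
Proof. by move=> x y z; apply/val_inj; exact: rmulA. Qed.

Lemma subrng_mulDl : left_distributive subrng_mul +%R.
Proof. by move=> x y z; apply/val_inj; exact: rmulDl. Qed.

Lemma subrng_mulDr : right_distributive subrng_mul +%R.
Proof. by move=> x y z; apply/val_inj; exact: rmulDr. Qed.

HB.instance Definition _ :=
  isRng.Build subrng_type subrng_mulA subrng_mulDl subrng_mulDr.

End SubrngType.

Section RngQuotient.
Variables (R : rngType) (I : rngIdeal R).

(* [Quotient.quot I] is the library's quotient of the additive group of [R]
   by the additive subgroup [I]. *)
Definition rng_quot : Type := Quotient.quot I.

HB.instance Definition _ := GRing.Zmodule.on rng_quot.
HB.instance Definition _ := EqQuotient.on rng_quot.

Definition rng_quot_mul : rng_quot -> rng_quot -> rng_quot :=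
  lift_op2 rng_quot (@rmul R).

Lemma pi_rng_quot_mul : {morph \pi_rng_quot : x y / x ** y >-> rng_quot_mul x y}.
Proof.
move=> x y; unlock rng_quot_mul; apply/eqP.
rewrite -Quotient.idealrBE.
set x' := repr _; set y' := repr _.
have xx' : x - x' \in (I : {pred R}).
  by rewrite Quotient.idealrBE; apply/eqP; rewrite reprK.
have yy' : y - y' \in (I : {pred R}).
  by rewrite Quotient.idealrBE; apply/eqP; rewrite reprK.
have -> : x ** y - x' ** y' = (x - x') ** y + x' ** (y - y').
  by rewrite rmulBl rmulBr addrA subrK.
by apply: rpredD; [exact: rngIdealMr | exact: rngIdealMl].
Qed.

Lemma pi_rng_quotD : {morph \pi_rng_quot : x y / x + y >-> x + y}.
Proof. exact: Quotient.pi_add. Qed.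

Lemma rng_quot_mulA : associative rng_quot_mul.
Proof.
move=> x y z; rewrite -[x]reprK -[y]reprK -[z]reprK.
by rewrite -!pi_rng_quot_mul rmulA.
Qed.

Lemma rng_quot_mulDl : left_distributive rng_quot_mul +%R.
Proof.
move=> x y z; rewrite -[x]reprK -[y]reprK -[z]reprK.
by rewrite -!(pi_rng_quotD, pi_rng_quot_mul) rmulDl.
Qed.

Lemma rng_quot_mulDr : right_distributive rng_quot_mul +%R.
Proof.
move=> x y z; rewrite -[x]reprK -[y]reprK -[z]reprK.
by rewrite -!(pi_rng_quotD, pi_rng_quot_mul) rmulDr.
Qed.

HB.instance Definition _ :=
  isRng.Build rng_quot rng_quot_mulA rng_quot_mulDl rng_quot_mulDr.

End RngQuotient.

(* The products of n+1 elements are the products x ** s_1 ** ... ** s_n. *)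
Definition nilpotent_class_le (S : rngType) (n : nat) : Prop :=
  forall (x : S) (s : n.-tuple S), foldl (@rmul S) x s = 0.

Section ApproximateSubrings.
Variable R : rngType.
Implicit Types X Y Z : set R.

Definition setadd Y Z : set R := [set y + z | y in Y & z in Z].
Definition setmul Y Z : set R := [set y ** z | y in Y & z in Z].

(* Repetitions are allowed in [s], so this says "at most k translates". *)
Definition covered_by_translates (k : nat) Y Z : Prop :=
  exists2 s : seq R, (size s <= k)%N & Y `<=` setadd [set` s] Z.

Definition additively_symmetric X : Prop :=
  X 0 /\ X = [set - x | x in X].

Definition approximate_subring (K : nat) X : Prop :=
  additively_symmetric X /\
  covered_by_translates K (setmul X X `|` setadd X X) X.

Fixpoint approx_iter X (n : nat) : set R :=
  if n is m.+1 then
    let Xm := approx_iter X m in setadd (setadd Xm Xm) (setmul Xm Xm)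
  else X.

End ApproximateSubrings.

(* Main.v *)
(* Bohr sets give the local structure of X. Let M = (2X + XX) - (2X + XX), which lies in
   X_2. Over a finite family of characters R -> R/Z that is orthogonal on a large finite set,
   consider the spectrum of those t for which both sum_{x in X} cos(2 pi t(x)) and
   sum_{a, b in X} cos(2 pi t(ab)) are large. By Bogolyubov's positivity argument every relevant
   x with t(x) near 0 for all t in the spectrum lies in M. By Sanders' almost invariant sumsets
   and Bessel's inequality the spectrum is totally bounded on X; hence, t(ab) having a large mean,
   so are the maps t(a _) and t(_ a), and X is covered by boundedly many translates of the balls
   of N(x) = max of |t(x)|, |t(xm)|, |t(mx)| over t in the spectrum and m in M.

   N satisfies N(2x) = 2 N(x) near 0 and, as small elements of M multiply into M, dyadic scaling
   in both factors makes N submultiplicative up to a constant on a small ball B. Take successive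
   minima u_1, u_2, ... of N on B modulo H = {N = 0}. An element of B contracts N, so it multiplies
   u_{i+1} into H + <u_1, ..., u_i>. The dilates 2^{p_i} u_i of norm about the radius of B are
   separated, so their number d is at most a covering number. Then R' = H + <u_1, ..., u_d> and
   I = H. *)
Require Import Defs.
From HB Require Import structures.
From mathcomp Require Import all_boot all_order all_algebra ring_quotient generic_quotient.
From mathcomp Require Import finmap.
From mathcomp Require Import boolp classical_sets functions cardinality.
From mathcomp Require Import Rstruct.
From mathcomp Require Import reals trigo.
From mathcomp Require Import zify ring lra.

Set Implicit Arguments.
Unset Strict Implicit.
Unset Printing Implicit Defensive.

Import Order.TTheory GRing.Theory Num.Theory.

Local Open Scope classical_set_scope.
Local Open Scope ring_scope.

(** * The circle R/Z *)

(** R may be infinite and carries no measure, so Fourier analysis runs over a finite family of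
    characters, orthogonal only at the finitely many differences that the argument meets. Its size
    is not bounded in terms of K; every covering bound is therefore proved for all maps additive
    modulo 1 at once, and depends only on K, the cutoff and the radius.

    The obstacle is multiplicative: smallness of x on the spectrum says nothing about xm. Putting
    t(xm) and t(mx) for all m in M into N makes it say that xm and mx lie in M when they are tested,
    but adds an unbounded number of conditions, and the balls of N must still be large. This is why
    the spectrum also asks for a large sum over products: that sum forces many of the maps t(a _)
    into the large additive spectrum, which is totally bounded. Accordingly the positivity argument
    is run on the convolution of two copies of X with the law of ab, whose transform is the square
    of the first sum times the second. *)

Section Circle.
Variable RR : realType.
Implicit Types t u d : RR.

(** The distance from [t] to the nearest integer, that is, the norm of R/Z; [floor (t + 1/2)] is
    such an integer. *)
Definition nrm t : RR := `|t - (Num.floor (t + 2^-1))%:~R|.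

Lemma nrm_intE t : exists m : int, nrm t = `|t - m%:~R|.
Proof. by exists (Num.floor (t + 2^-1)). Qed.

Lemma nrm_half t : nrm t <= 2^-1.
Proof.
have /andP[h1 h2] := floor_itv (t + 2^-1).
rewrite /nrm ler_norml; move: h1 h2; rewrite intrD; lra.
Qed.

Lemma nrm_small u : `|u| <= 2^-1 -> forall m : int, `|u| <= `|u - m%:~R|.
Proof.
move=> hu m; have [->|m0] := eqVneq m 0; first by rewrite subr0.
have : 1 <= `|m%:~R : RR|.
  by rewrite -intr_norm -[1]/(1%:~R) ler_int -gtz0_ge1 normr_gt0.
have := ler_normB (u - m%:~R) u.
have -> : u - m%:~R - u = - m%:~R by ring.
rewrite normrN; lra.
Qed.

Lemma nrm_le t (m : int) : nrm t <= `|t - m%:~R|.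
Proof.
have h := nrm_half t; rewrite {1}/nrm.
have := nrm_small h (m - Num.floor (t + 2^-1)).
by rewrite intrB opprB addrA subrK.
Qed.

Lemma nrm_ge0 t : 0 <= nrm t. Proof. exact: normr_ge0. Qed.

Lemma nrm_abs t : `|t| <= 2^-1 -> nrm t = `|t|.
Proof.
move=> ht; apply/le_anti/andP; split; first by have := nrm_le t 0; rewrite subr0.
exact: nrm_small.
Qed.

Lemma nrmD t u : nrm (t + u) <= nrm t + nrm u.
Proof.
have [m ->] := nrm_intE t; have [k ->] := nrm_intE u.
apply: le_trans (nrm_le _ (m + k)) _.
by rewrite intrD opprD addrACA ler_normD.
Qed.

Lemma nrmN t : nrm (- t) = nrm t.
Proof.
wlog suff : t / nrm (- t) <= nrm t.
  by move=> h; apply/le_anti; rewrite h -{1}[t]opprK h.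
have [m ->] := nrm_intE t; apply: le_trans (nrm_le _ (- m)) _.
by rewrite intrN -opprD normrN.
Qed.

Lemma nrmB t u : nrm (t - u) <= nrm t + nrm u.
Proof. by apply: le_trans (nrmD _ _) _; rewrite nrmN. Qed.

Lemma nrmDz t (m : int) : nrm (t + m%:~R) = nrm t.
Proof.
wlog suff : t m / nrm (t + m%:~R) <= nrm t.
  move=> h; apply/le_anti; rewrite h /=.
  by have := h (t + m%:~R) (- m); rewrite intrN addrK.
have [k ->] := nrm_intE t; apply: le_trans (nrm_le _ (k + m)) _.
by rewrite intrD opprD addrACA subrr addr0.
Qed.

Lemma nrm0 : nrm 0 = 0. Proof. by rewrite nrm_abs ?normr0 ?invr_ge0. Qed.

Lemma nrm_eq0 t : nrm t = 0 -> exists m : int, t = m%:~R.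
Proof.
have [m ->] := nrm_intE t; move=> /eqP; rewrite normr_eq0 subr_eq0 => /eqP ->.
by exists m.
Qed.

(** A representative of size at most 1/4 doubles to one of size at most 1/2, where [nrm] is still
    the absolute value. All dyadic scaling of the norm N comes from here. *)
Lemma nrm_double t : nrm t <= 4^-1 -> nrm (t *+ 2) = nrm t *+ 2.
Proof.
have [m ->] := nrm_intE t => h.
have -> : t *+ 2 = (t - m%:~R) *+ 2 + (m *+ 2)%:~R by rewrite mulrnBl rmorphMn subrK.
rewrite nrmDz nrm_abs normrMn //.
by rewrite -mulr_natr; move: h; lra.
Qed.

(** Real and imaginary parts of e(t) = exp(2 pi i t); complex sums are carried as pairs of real
    ones. *)
Definition cos1 t := cos (2 * pi * t).
Definition sin1 t := sin (2 * pi * t).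

Lemma cos1D t u : cos1 (t + u) = cos1 t * cos1 u - sin1 t * sin1 u.
Proof. by rewrite /cos1 mulrDr cosD. Qed.
Lemma sin1D t u : sin1 (t + u) = sin1 t * cos1 u + cos1 t * sin1 u.
Proof. by rewrite /sin1 mulrDr sinD. Qed.
Lemma cos1N t : cos1 (- t) = cos1 t.
Proof. by rewrite /cos1 mulrN cosN. Qed.
Lemma sin1N t : sin1 (- t) = - sin1 t.
Proof. by rewrite /sin1 mulrN sinN. Qed.
Lemma cos1_le1 t : cos1 t <= 1. Proof. exact: cos_le1. Qed.
Lemma cos1_geN1 t : -1 <= cos1 t. Proof. exact: cos_geN1. Qed.
Lemma norm_cos1 t : `|cos1 t| <= 1. Proof. by rewrite ler_norml cos1_le1 cos1_geN1. Qed.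
Lemma norm_sin1 t : `|sin1 t| <= 1. Proof. by rewrite ler_norml sin_le1 sin_geN1. Qed.
Lemma cos1sin1 t : cos1 t ^+ 2 + sin1 t ^+ 2 = 1. Proof. exact: cos2Dsin2. Qed.
Lemma cos1_0 : cos1 0 = 1. Proof. by rewrite /cos1 mulr0 cos0. Qed.
Lemma sin1_0 : sin1 0 = 0. Proof. by rewrite /sin1 mulr0 sin0. Qed.

Lemma cos1_sin1_int (m : int) : cos1 m%:~R = 1 /\ sin1 m%:~R = 0.
Proof.
have h (n : nat) : cos1 n%:R = 1 /\ sin1 n%:R = 0.
  elim: n => [|n [IHc IHs]]; first by rewrite cos1_0 sin1_0.
  rewrite -natr1 cos1D sin1D IHc IHs /cos1 /sin1 mulr1 mulr_natl.
  by rewrite cos2pi sin2pi; split; ring.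
case: (intP m) => [|n|n]; [exact: (h 0%N) | exact: (h n.+1) |].
by rewrite intrN cos1N sin1N; have [-> ->] := h n.+1; rewrite oppr0.
Qed.

Lemma cos1Dz t (m : int) : cos1 (t + m%:~R) = cos1 t.
Proof. by rewrite cos1D; have [-> ->] := cos1_sin1_int m; rewrite mulr1 mulr0 subr0. Qed.

Lemma sin1Dz t (m : int) : sin1 (t + m%:~R) = sin1 t.
Proof. by rewrite sin1D; have [-> ->] := cos1_sin1_int m; rewrite mulr1 mulr0 addr0. Qed.

Lemma cos1_nrm t : cos1 t = cos1 (nrm t).
Proof.
have [m ->] := nrm_intE t.
have -> : cos1 `|t - m%:~R| = cos1 (t - m%:~R).
  by by case: (ler0P (t - m%:~R)) => _ //; rewrite cos1N.
by rewrite -intrN cos1Dz.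
Qed.

Lemma cos1_mono t u : 0 <= t -> t <= u -> u <= 2^-1 -> cos1 u <= cos1 t.
Proof.
move=> t0 tu u2; have p0 := pi_gt0 RR; rewrite /cos1 le_eqVlt.
have [->|ne] := eqVneq t u; first by rewrite eqxx.
have lt : t < u by rewrite lt_neqAle ne.
rewrite ltr_cos ?in_itv /= ?ltr_pM2l ?mulr_gt0 ?lt ?orbT //.
all: by apply/andP; split; nra.
Qed.

Lemma cos1_near t : nrm t <= 8^-1 -> 2^-1 <= cos1 t.
Proof.
move=> h; rewrite cos1_nrm.
apply: le_trans (cos1_mono (nrm_ge0 _) h _); last by lra.
have p0 := pi_gt0 RR.
have c0 : 0 <= cos1 (8^-1) by apply: cos_ge0_pihalf; lra.
(* By the addition formula, [cos1 (1/4) = 0] makes the squares of cosine and sine at 1/8 equal, so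
   both are 1/2. *)
have : cos1 (8^-1 + 8^-1) = 0.
  by rewrite /cos1 -(cos_pihalf RR); congr cos; field.
rewrite cos1D; have := cos1sin1 (8^-1); nra.
Qed.

Lemma cos1_far d : 0 < d -> d <= 2^-1 ->
  exists2 e, 0 < e & forall t, d <= nrm t -> cos1 t <= 1 - e.
Proof.
move=> d0 d2; exists (1 - cos1 d); last first.
  by move=> t dt; rewrite subKr cos1_nrm; apply: cos1_mono dt (nrm_half t); exact: ltW.
have p0 := pi_gt0 RR.
have h0 : 0 \in `[0, pi : RR] by rewrite in_itv /= lexx ltW.
have hd : 2 * pi * d \in `[0, pi : RR] by rewrite in_itv /=; apply/andP; split; nra.
by rewrite subr_gt0 -(@cos0 RR) ltr_cos // !mulr_gt0.
Qed.

Lemma cos1_eq1 t : cos1 t = 1 -> exists m : int, t = m%:~R.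
Proof.
move=> ct; apply: nrm_eq0; apply/eqP; apply: contraT => n0.
have [||e e0 /(_ t (lexx _))] := @cos1_far (nrm t); last by rewrite ct; lra.
  by rewrite lt_neqAle eq_sym n0 nrm_ge0.
exact: nrm_half.
Qed.

End Circle.

(** * Characters separating points *)

Lemma invr_nat_nint (n : nat) : (1 < n)%N -> n%:R^-1 \isn't a @Num.int rat.
Proof.
move=> n1; apply/negP => /intrP[m nm].
have m0 : 0 < m%:~R :> rat by rewrite -nm invr_gt0 ltr0n; lia.
have m1 : m%:~R < 1%:~R :> rat by rewrite -nm invf_lt1 ?ltr1n ?ltr0n //; lia.
by move: m0 m1; rewrite ltr0z ltr_int; lia.
Qed.

Section Separation.
Variable V : zmodType.
Implicit Types (G : set (V * rat)) (x y : V) (q w : rat).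

(** Graphs in V x Q of homomorphisms to Q/Z: the fibre over 0 is the ambiguity of the values, so it
    may contain integers only. *)
Definition partial_char G :=
  (forall g h, G g -> G h -> G (g - h)) /\ (forall q, G (0, q) -> q \is a Num.int).

Lemma partial_charZ G g (k : int) : partial_char G -> G g -> G (g *~ k).
Proof.
move=> [GB _] Gg.
have G0 : G 0 by rewrite -(subrr g); exact: GB.
have GN h : G h -> G (- h) by rewrite -[- h]add0r; exact: GB.
have Gn (n : nat) : G (g *+ n).
  elim: n => [|n IH]; first by rewrite mulr0n.
  by rewrite mulrSr -[g in _ + g]opprK; apply: GB => //; exact: GN.
by case: (intP k) => [|n|n]; rewrite ?mulr0z ?mulrNz -?pmulrn //; exact/GN.
Qed.

Lemma pairMz x q (k : int) : (x, q) *~ k = (x *~ k, q *~ k).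
Proof.
have h (n : nat) : (x, q) *+ n = (x *+ n, q *+ n).
  by elim: n => [|n IH]; rewrite ?mulr0n // !mulrS IH.
by case: (intP k) => [|n|n]; rewrite ?mulr0z ?mulrNz -?pmulrn ?h.
Qed.

(** Divisibility of Q. If no positive multiple of [x] is in the domain, any value will do, such as
    1/2. Otherwise take the least such multiple [n], with value [qn]: both [qn / n] and
    [qn / n + 1 / n] are admissible, and they are not both integers because [n > 1], as [x] itself
    is not in the domain. *)
Lemma partial_char_slope G x : partial_char G -> G (0, 1) -> (forall q, ~ G (x, q)) ->
  exists2 w, w \isn't a Num.int &
    forall (k : int) q, G (x *~ k, q) -> w *~ k - q \is a Num.int.
Proof.
move=> pG G1 Gx; have [GB Gint] := pG.
pose P n := `[< (0 < n)%N /\ exists q, G (x *+ n, q) >].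
have [exP|noP] := pselect (exists n, P n); last first.
  exists 2^-1 => [|k q Gk]; first exact: (@invr_nat_nint 2).
  have [k0|k0] := eqVneq k 0.
    by rewrite k0 mulr0z sub0r rpredN; apply: Gint; move: Gk; rewrite k0 mulr0z.
  case: noP; exists `|k|%N; apply/asboolP; split; first by rewrite absz_gt0.
  case: (intP k) k0 Gk => [//|n|n] _ Gk; first by exists q.
  exists (- q); have := partial_charZ (- 1) pG Gk.
  by rewrite pairMz mulrNz !mulrN1z opprK abszN.
case: (ex_minnP exP) => n /asboolP[n0 [qn Gn]] nmin.
have n1 : (1 < n)%N.
  by rewrite ltn_neqAle n0 andbT; apply/eqP => n1; apply: (Gx qn); rewrite -n1 in Gn.
have nn0 : n%:R != 0 :> rat by rewrite pnatr_eq0 -lt0n.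
(* By minimality of [n], only multiples of [n] bring [x] into the domain, so it is enough that [w]
   fit at [n]. *)
have key w (k : int) q : (w * n%:R - qn) \is a Num.int ->
    G (x *~ k, q) -> w *~ k - q \is a Num.int.
  move=> wn Gk.
  have [/eqP r0|r0] := boolP ((k %% n)%Z == 0); last first.
    have r0' : 0 <= (k %% n)%Z by apply: modz_ge0; lia.
    have rn : (k %% n)%Z < n by apply: ltz_pmod; lia.
    suff /nmin : P `|(k %% n)%Z|%N by lia.
    apply/asboolP; split; first by rewrite absz_gt0.
    exists (q - qn *~ (k %/ n)%Z).
    have -> : x *+ `|(k %% n)%Z|%N = x *~ k - (x *+ n) *~ (k %/ n)%Z.
      rewrite pmulrn gez0_abs // pmulrn -mulrzA -mulrzBr; congr (_ *~ _).
      by apply/eqP; rewrite eq_sym subr_eq addrC mulrC -divz_eq.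
    rewrite -[(_, _)]/((x *~ k, q) - ((x *+ n) *~ (k %/ n)%Z, qn *~ (k %/ n)%Z)).
    by apply: GB => //; rewrite -pairMz; exact: partial_charZ.
  have kE : k = (k %/ n)%Z * n by have := divz_eq k n; rewrite r0 addr0.
  have h1 : q - qn *~ (k %/ n)%Z \is a Num.int.
    apply: Gint.
    have <- : x *~ k - (x *+ n) *~ (k %/ n)%Z = 0.
      by rewrite {1}kE pmulrn -mulrzA [n%:Z * _]mulrC subrr.
    rewrite -[(_, _)]/((x *~ k, q) - ((x *+ n) *~ (k %/ n)%Z, qn *~ (k %/ n)%Z)).
    by apply: GB => //; rewrite -pairMz; exact: partial_charZ.
  have -> : w *~ k - q = (w * n%:R - qn) *~ (k %/ n)%Z - (q - qn *~ (k %/ n)%Z).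
    rewrite {1}kE mulrzBl mulrC mulrzA -pmulrn -mulr_natr; ring.
  by rewrite rpredB // rpredMz.
have [wi|wi] := boolP (qn / n%:R \is a Num.int); last first.
  by exists (qn / n%:R) => // k q; apply: key; rewrite mulfVK ?subrr ?rpred0.
exists (qn / n%:R + n%:R^-1).
  by rewrite (rpredDl _ wi) invr_nat_nint.
by move=> k q; apply: key; rewrite mulrDl mulfVK // mulVf // addrAC subrr add0r rpred1.
Qed.

Lemma partial_char_extend G x w : partial_char G ->
  (forall (k : int) q, G (x *~ k, q) -> w *~ k - q \is a Num.int) -> G (0, 1) ->
  let G' := [set g | exists k : int, G (g - (x, w) *~ k)] in
  [/\ partial_char G', G `<=` G' & G' (x, w)].
Proof.
move=> [GB Gint] Gw G1 /=; split; first split.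
- move=> g h [k Gk] [l Gl]; exists (k - l).
  have -> : g - h - (x, w) *~ (k - l) = (g - (x, w) *~ k) - (h - (x, w) *~ l).
    by rewrite mulrzBr !opprB [X in _ - _ + X = _]addrC addrACA [- h + _]addrC.
  exact: GB.
- move=> q [k]; rewrite pairMz => h.
  have {h} : G (0 - x *~ k, q - w *~ k) by [].
  rewrite sub0r -mulrNz => /Gw.
  by rewrite mulrNz opprB addKr rpredN.
- by move=> g Gg; exists 0; rewrite mulr0z subr0.
- exists 1; have -> : (x, w) - (x, w) *~ 1 = 0 by rewrite mulr1z subrr.
  by have := GB _ _ G1 G1; rewrite subrr.
Qed.

(** A character to the circle, given by an arbitrary lift of its values. *)
Definition is_mod1 (F : archiRealDomainType) (th : V -> F) :=
  forall x y, th (x + y) - (th x + th y) \is a Num.int.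

(* Injectivity of Q/Z, by Zorn's lemma on graphs of partial characters. *)
Lemma rat_char_separates x : x != 0 ->
  exists2 th : V -> rat, is_mod1 th & th x \isn't a Num.int.
Proof.
move=> x0.
pose G0 : set (V * rat) := [set g | g.1 = 0 /\ g.2 \is a Num.int].
have pG0 : partial_char G0.
  split=> [[a b] [c d] [/= -> ib] [/= -> id]|q []] //.
  by split; rewrite /= ?subrr ?rpredB.
have G01 : G0 (0, 1) by split => //=; exact: rpred1.
have [q [] /= /eqP|w wi Gw] := partial_char_slope pG0 G01 (x := x).
  by rewrite (negbTE x0).
have [pG1 G01' G1x] := partial_char_extend pG0 Gw G01.
set G1 := (X in partial_char X) in pG1; rewrite -/G1 in G01' G1x.
(* Conditional on nonemptiness, because the empty union of the empty chain must satisfy the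
   predicate. *)
pose P : set (set (V * rat)) := [set G | (exists g, G g) ->
  [/\ partial_char G, G (0, 1) & G (x, w)]].
have [F FP Ftot|A [PA Amax]] := @Zorn_bigcup _ P.
  move=> [g [B FB Bg]].
  have [_ B1 Bx] := FP _ FB (ex_intro _ _ Bg).
  split; [split|by exists B|by exists B].
    move=> h k [C FC Ch] [D FD Dk].
    have [CD|DC] := Ftot _ _ FC FD.
      exists D => //; have [[DB _] _ _] := FP _ FD (ex_intro _ _ Dk).
      by apply: DB => //; exact: CD.
    exists C => //; have [[CB _] _ _] := FP _ FC (ex_intro _ _ Ch).
    by apply: CB => //; exact: DC.
  move=> q [C FC Cq]; have [[_ +] _ _] := FP _ FC (ex_intro _ _ Cq); exact.
have [pA A1 Ax] : [/\ partial_char A, A (0, 1) & A (x, w)].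
  apply: PA; have [//|nA] := pselect (exists g, A g).
  case: (Amax G1); last by split => //; exact: G01'.
  split=> [g Ag|G1A]; first by case: nA; exists g.
  by case: nA; exists (x, w); exact: G1A.
have Atot y : exists q, A (y, q).
  have [//|nA] := pselect (exists q, A (y, q)).
  have [q Aq|v vi Av] := partial_char_slope pA A1 (x := y).
    by apply: nA; exists q.
  have [pB AB By] := partial_char_extend pA Av A1.
  case: (Amax _ (conj AB _)) => [BA|_]; last by split=> //; exact: AB.
  by apply: nA; exists v; exact: BA.
have [th thP] := choice Atot.
exists th => [y z|].
  apply: pA.2; rewrite -[X in (X, _)](subrr (y + z)) opprD.
  have -> : (y + z + (- y - z), th (y + z) - (th y + th z))
      = (y + z, th (y + z)) - (y, th y) - (z, th z).
    by congr (_, _); rewrite /= ?addrA ?opprD ?addrA.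
  by apply: pA.1 => //; apply: pA.1.
apply: contra wi => thi; rewrite -[w](subrK (th x)) rpredD //.
apply: pA.2; rewrite -(subrr x).
by apply: (pA.1 (x, w) (x, th x)).
Qed.

End Separation.

(** * Characters with values in R/Z and finite orthogonal families of them *)

Section Mod1.
Variables (RR : realType) (V : zmodType).
Implicit Types (th : V -> RR) (x y : V) (a b : RR).

Lemma cos1_eqz a b : a - b \is a Num.int -> cos1 a = cos1 b.
Proof. by move=> /intrP[m ab]; rewrite -[a](subrK b) ab addrC cos1Dz. Qed.
Lemma sin1_eqz a b : a - b \is a Num.int -> sin1 a = sin1 b.
Proof. by move=> /intrP[m ab]; rewrite -[a](subrK b) ab addrC sin1Dz. Qed.
Lemma nrm_eqz a b : a - b \is a Num.int -> nrm a = nrm b.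
Proof. by move=> /intrP[m ab]; rewrite -[a](subrK b) ab addrC nrmDz. Qed.

Section OneCharacter.
Variable th : V -> RR.
Hypothesis thD : is_mod1 th.

Lemma mod1_0 : th 0 \is a Num.int.
Proof. by have := thD 0 0; rewrite addr0 opprD addrA subrr sub0r rpredN. Qed.

Lemma mod1N x : th (- x) - (- th x) \is a Num.int.
Proof.
have := thD (- x) x; rewrite addNr opprK => h.
by have := rpredB mod1_0 h; rewrite opprB addrC subrK.
Qed.

Lemma mod1B x y : th (x - y) - (th x - th y) \is a Num.int.
Proof.
have := rpredD (thD x (- y)) (mod1N y); congr (_ \is a Num.int); ring.
Qed.

Lemma nrm_mod1_0 : nrm (th 0) = 0.
Proof. by rewrite (@nrm_eqz _ 0) ?nrm0 // subr0 mod1_0. Qed.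
Lemma nrm_mod1D x y : nrm (th (x + y)) = nrm (th x + th y).
Proof. exact: nrm_eqz. Qed.
Lemma nrm_mod1N x : nrm (th (- x)) = nrm (th x).
Proof. by rewrite -[RHS]nrmN; apply/nrm_eqz/mod1N. Qed.
Lemma nrm_mod1B x y : nrm (th (x - y)) = nrm (th x - th y).
Proof. exact/nrm_eqz/mod1B. Qed.
Lemma nrm_mod1D_le x y : nrm (th (x + y)) <= nrm (th x) + nrm (th y).
Proof. by rewrite nrm_mod1D nrmD. Qed.
Lemma nrm_mod1B_le x y : nrm (th (x - y)) <= nrm (th x) + nrm (th y).
Proof. by rewrite nrm_mod1B nrmB. Qed.
Lemma cos1_mod1_0 : cos1 (th 0) = 1.
Proof. by rewrite (@cos1_eqz _ 0) ?cos1_0 // subr0 mod1_0. Qed.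
Lemma cos1_mod1D x y : cos1 (th (x + y)) = cos1 (th x) * cos1 (th y) - sin1 (th x) * sin1 (th y).
Proof. by rewrite -cos1D; apply: cos1_eqz. Qed.
Lemma sin1_mod1D x y : sin1 (th (x + y)) = sin1 (th x) * cos1 (th y) + cos1 (th x) * sin1 (th y).
Proof. by rewrite -sin1D; apply: sin1_eqz. Qed.
Lemma cos1_mod1N x : cos1 (th (- x)) = cos1 (th x).
Proof. by rewrite -[RHS]cos1N; apply/cos1_eqz/mod1N. Qed.
Lemma sin1_mod1N x : sin1 (th (- x)) = - sin1 (th x).
Proof. by rewrite -sin1N; apply/sin1_eqz/mod1N. Qed.

End OneCharacter.

Lemma is_mod1_sub (t u : V -> RR) : is_mod1 t -> is_mod1 u -> is_mod1 (fun x => t x - u x).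
Proof.
move=> tD uD x y; have := rpredB (tD x y) (uD x y).
by congr (_ \is a Num.int); ring.
Qed.

(** Reindexing by [s] rotates the vector of the cosine and sine sums by the angle 2 pi a; a
    nontrivial rotation fixes only 0. *)
Lemma sum_cos1_shift (I : finType) (phi : I -> RR) (s : I -> I) a :
  injective s -> (forall i, phi (s i) - (phi i + a) \is a Num.int) ->
  a \isn't a Num.int -> \sum_i cos1 (phi i) = 0.
Proof.
move=> sI phis ai.
set C := \sum_i _; pose S := \sum_i sin1 (phi i).
have eC : C = C * cos1 a - S * sin1 a.
  rewrite {1}/C (reindex_inj sI) /= !mulr_suml -sumrB.
  by apply: eq_bigr => i _; rewrite (cos1_eqz (phis i)) cos1D.
have eS : S = S * cos1 a + C * sin1 a.
  rewrite {1}/S (reindex_inj sI) /= !mulr_suml -big_split.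
  by apply: eq_bigr => i _; rewrite (sin1_eqz (phis i)) sin1D.
have := cos1sin1 a => cs.
have key : C * (1 - cos1 a) = 0.
  have : C * (1 - cos1 a) *+ 2 = (C - (C * cos1 a - S * sin1 a)) * (1 - cos1 a)
    - (S - (S * cos1 a + C * sin1 a)) * sin1 a - C * (cos1 a ^+ 2 + sin1 a ^+ 2 - 1).
    by ring.
  rewrite -eC -eS !subrr cs subrr !mul0r mulr0 !subr0 => /eqP.
  by rewrite mulrn_eq0 /= => /eqP.
move/eqP: key; rewrite mulf_eq0 => /orP[/eqP //|].
rewrite subr_eq0 eq_sym => /eqP/cos1_eq1[m am].
by case/negP: ai; rewrite am rpred_int.
Qed.

Lemma common_denominator (l : seq rat) :
  exists2 n : nat, (0 < n)%N & forall r, r \in l -> r * n%:R \is a Num.int.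
Proof.
elim: l => [|r l [n n0 hn]]; first by exists 1%N.
exists (`|denq r| * n)%N; first by rewrite muln_gt0 absz_gt0 denq_neq0.
move=> u; rewrite inE => /orP[/eqP ->|/hn un].
  rewrite natrM mulrA rpredM ?rpred_nat //.
  by rewrite pmulrn gez0_abs ?denq_ge0 // -numqE rpred_int.
by rewrite natrM mulrCA rpredM ?rpred_nat.
Qed.

(** A finite substitute for integration over the dual group. Take one separating character per point
    of [Q] and all combinations of these with coefficients modulo a common denominator of their
    values on [Q]. Raising the coefficient of the character of [q] by one permutes the family and
    shifts [g i q] by a nonintegral constant; modulo 1 this holds also when the coefficient wraps
    around. *)
Lemma char_family (Q : seq V) :
  exists (I : finType) (g : I -> V -> RR), [/\ (0 < #|I|)%N, forall i, is_mod1 (g i) &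
    forall q, q \in Q -> q != 0 -> \sum_i cos1 (g i q) = 0].
Proof.
have /choice[th thP] : forall x : V, exists th : V -> rat,
    is_mod1 th /\ (x != 0 -> th x \isn't a Num.int).
  move=> x; have [->|x0] := eqVneq x 0.
    by exists (fun=> 0); split => // y z; rewrite addr0 subr0.
  by have [th h1 h2] := rat_char_separates x0; exists th.
have [[|N] // _ NP] := common_denominator [seq th x y | x <- Q, y <- Q].
pose I := {ffun 'I_(size Q) -> 'I_N.+1}.
pose g (f : I) x : RR := \sum_k (f k)%:R * ratr (th Q`_k x).
have ratrZ (r : rat) : r \is a Num.int -> (ratr r : RR) \is a Num.int.
  by move=> /intrP[m ->]; rewrite ratr_int rpred_int.
exists I, g; split=> [|f x y|q qQ q0].
- by apply/card_gt0P; exists [ffun=> ord0].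
- rewrite /g -big_split -sumrB rpred_sum //= => k _.
  rewrite -mulrDr -mulrBr rpredM ?rpred_nat //.
  by rewrite -rmorphD -rmorphB /= ratrZ //; exact: (thP _).1.
pose k0 : 'I_(size Q) := Ordinal (etrans (index_mem q Q) qQ).
have k0E : Q`_k0 = q by rewrite /= nth_index.
pose s (f : I) : I := [ffun k => if k == k0 then inord ((f k).+1 %% N.+1) else f k].
apply: (@sum_cos1_shift _ _ s (ratr (th q q))).
- move=> f f' /ffunP e; apply/ffunP => k; have := e k; rewrite !ffunE.
  case: eqP => // _ /(congr1 val); rewrite /= !inordK ?ltn_mod // => e1.
  apply/val_inj => /=; have := ltn_ord (f k); have := ltn_ord (f' k).
  have : f k = f' k %[mod N.+1] by apply/eqP; rewrite -(eqn_modDr 1) !addn1 e1.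
  by move=> + h h'; rewrite !modn_small.
- move=> f; rewrite /g (bigD1 k0) //= [in X in - (X + _)](bigD1 k0) //=.
  rewrite (eq_bigr (fun k : 'I_(size Q) => (f k)%:R * ratr (th Q`_k q))); last first.
    by move=> k kk; rewrite ffunE (negbTE kk).
  rewrite ffunE eqxx inordK ?ltn_mod // nth_index //.
  set B := \sum_(i < _ | _) _; set t : RR := ratr _.
  have -> : ((f k0).+1 %% N.+1)%:R * t + B - ((f k0)%:R * t + B + t) =
      - (((f k0).+1 %/ N.+1)%:R * (t * N.+1%:R)).
    have := divn_eq (f k0).+1 N.+1 => /(congr1 (fun n => n%:R : RR)).
    rewrite natrD natrM -natr1 => e.
    have -> : ((f k0).+1 %% N.+1)%:R =  (f k0)%:R + 1 - ((f k0).+1 %/ N.+1)%:R * N.+1%:R :> RR.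
      by rewrite e addrC addKr.
    by ring.
  rewrite rpredN rpredM ?rpred_nat // /t.
  rewrite -[N.+1%:R](ratr_nat RR) -rmorphM /= ratrZ //.
  by apply: NP; apply/allpairsP; exists (q, q).
apply: contra ((thP q).2 q0) => /intrP[m]; rewrite -[m%:~R](ratr_int RR) => /fmorph_inj ->.
exact: rpred_int.
Qed.

End Mod1.

(** * Colorings and nets *)

Section Colorings.
Variable T : Type.
Implicit Types (P Q : T -> Prop) (rel : T -> T -> Prop) (m n : nat).

(** Total boundedness without centres. Colorings multiply and restrict to subsets, which nets do
    only at a loss in distance. *)
Definition colored n P rel := exists2 c : T -> nat,
  forall x, P x -> (c x < n)%N & forall x y, P x -> P y -> c x = c y -> rel x y.

Lemma colored_le m n P rel : (m <= n)%N -> colored m P rel -> colored n P rel.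
Proof. by move=> mn [c c1 c2]; exists c => // x /c1 h; exact: leq_trans mn. Qed.

Lemma colored_sub n P Q rel rel' : (forall x, Q x -> P x) ->
  (forall x y, Q x -> Q y -> rel x y -> rel' x y) -> colored n P rel -> colored n Q rel'.
Proof.
move=> QP h [c c1 c2]; exists c => [x /QP/c1 //|x y Qx Qy e].
by apply: h => //; apply: c2 => //; exact: QP.
Qed.

Lemma colored_and m n P rel rel' : colored m P rel -> colored n P rel' ->
  colored (m * n) P (fun x y => rel x y /\ rel' x y).
Proof.
move=> [c c1 c2] [d d1 d2]; exists (fun x => c x * n + d x)%N.
  move=> x Px; have := c1 _ Px; have := d1 _ Px => dn cm.
  by apply: (@leq_trans ((c x).+1 * n)); [rewrite mulSn addnC ltn_add2r | rewrite leq_mul2r cm orbT].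
move=> x y Px Py e; have dx := d1 _ Px; have dy := d1 _ Py.
have n0 : (0 < n)%N by apply: leq_ltn_trans dx.
split; [apply: c2 => // | apply: d2 => //].
  by have := congr1 (fun z => z %/ n)%N e; rewrite !divnMDl // !divn_small // !addn0.
by have := congr1 (fun z => z %% n)%N e; rewrite !modnMDl !modn_small.
Qed.

Lemma colored_all (I : finType) n P (rel : I -> T -> T -> Prop) :
  (forall i, colored n P (rel i)) ->
  colored (n ^ #|I|) P (fun x y => forall i, rel i x y).
Proof.
move=> h.
have /choice[c cP] i : exists c : T -> nat, (forall x, P x -> (c x < n)%N) /\
    forall x y, P x -> P y -> c x = c y -> rel i x y.
  by have [c] := h i; exists c.
case: n cP {h} => [|n] cP.
  exists (fun=> 0%N) => [x Px|x y Px _ _ i]; last by have := (cP i).1 x Px.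
  have /eqP -> : #|I| == 0%N; last by [].
  by apply/eqP/eq_card0 => i; have := (cP i).1 x Px.
pose F x : {ffun I -> 'I_n.+1} := [ffun i => inord (c i x)].
exists (fun x => nat_of_ord (enum_rank (F x))) => [x Px|x y Px Py e i].
  by have := ltn_ord (enum_rank (F x)); rewrite {2}card_ffun card_ord.
have /ffunP/(_ i) : F x = F y by apply/enum_rank_inj/val_inj.
rewrite !ffunE => /(congr1 val) /=.
by rewrite !inordK ?(cP i).1 //; exact: (cP i).2.
Qed.

Lemma colored_net n P rel : colored n P rel ->
  exists m (r : 'I_m -> T), [/\ (m <= n)%N, forall i, P (r i) &
    forall x, P x -> exists i, rel x (r i)].
Proof.
move=> [c c1 c2].
pose A := [set k : 'I_n | `[< exists2 x, P x & c x = k >]]%SET.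
have /choice[r rP] (i : 'I_#|A|) : exists x, P x /\ c x = enum_val i.
  by have := enum_valP i; rewrite inE => /asboolP[x Px cx]; exists x.
exists #|A|, r; split=> [|i|x Px]; first by rewrite -[n in (_ <= n)%N]card_ord max_card.
  by have [] := rP i.
have xA : Ordinal (c1 x Px) \in A by rewrite inE; apply/asboolP; exists x.
exists (enum_rank_in xA (Ordinal (c1 x Px))); apply: c2 => //; first by have [] := rP (enum_rank_in xA (Ordinal (c1 x Px))).
by have [_ ->] := rP (enum_rank_in xA (Ordinal (c1 x Px))); rewrite enum_rankK_in.
Qed.

Lemma net_colored m P rel (r : 'I_m -> T) rel' : (forall x, P x -> exists i, rel x (r i)) ->
  (forall x y i, P x -> P y -> rel x (r i) -> rel y (r i) -> rel' x y) ->
  colored m P rel'.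
Proof.
move=> cov h.
have /choice[c cP] x : exists i : nat, P x -> exists2 j : 'I_m, i = j & rel x (r j).
  have [/cov[i xi]|] := pselect (P x); last by exists 0%N.
  by exists i => _; exists i.
exists c => [x /cP[j -> _] //|x y Px Py].
have [i ->] := cP _ Px; have [j ->] := cP _ Py => yj xi /val_inj ij.
by apply: (h _ _ i) => //; rewrite ij.
Qed.

(** A maximal family of pairwise unrelated points is a net. If there were no net, such a family
    could be lengthened one point at a time up to the forbidden length [n]. *)
Lemma packing_net n P rel : (forall x y, rel x y -> rel y x) ->
  (forall f : 'I_n -> T, (forall i, P (f i)) -> exists i j, i != j /\ rel (f i) (f j)) ->
  exists m (r : 'I_m -> T), [/\ (m < n)%N, forall i, P (r i) &
    forall x, P x -> exists i, rel x (r i)].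
Proof.
move=> sym pack; apply: contrapT => noc.
have key m : (m <= n)%N -> exists2 f : 'I_m -> T, (forall i, P (f i)) &
    forall i j, i != j -> ~ rel (f i) (f j).
  elim: m => [_|m IH mn]; first by exists (fun i : 'I_0 => False_rect T (notF (ltn_ord i))); case.
  have [f fP fr] := IH (ltnW mn).
  have [x Px xf] : exists2 x, P x & forall i, ~ rel x (f i).
    apply: contrapT => nx; apply: noc; exists m, f; split=> // x Px.
    by apply: contrapT => nr; apply: nx; exists x => // i ri; apply: nr; exists i.
  exists (fun i => if unlift ord_max i is Some j then f j else x) => [i|i j].
    by case: unliftP.
  case: unliftP => [i' ->|->]; case: unliftP => [j' ->|->] //; last by rewrite eqxx.
  - by rewrite (inj_eq (@lift_inj _ _)); exact: fr.
  - by move=> _ /sym; exact: xf.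
have [f fP fr] := key n (leqnn n).
by have [i [j [ij rij]]] := pack f fP; exact: (fr _ _ ij).
Qed.

End Colorings.

Lemma colored_preim (T U : Type) (f : U -> T) n (P : T -> Prop) rel :
  colored n P rel -> colored n (fun u => P (f u)) (fun u v => rel (f u) (f v)).
Proof. by move=> [c c1 c2]; exists (c \o f) => [u /c1 //|u v]; exact: c2. Qed.

(** * Colorings defined by values of characters *)

Section CharacterColorings.
Variable RR : realType.

Lemma colored_value (d : RR) : 0 < d -> exists2 m, (0 < m)%N &
  forall (T : Type) (P : T -> Prop) (v : T -> RR), colored m P (fun x y => nrm (v x - v y) <= d).
Proof.
move=> d0; pose m := (Num.truncn d^-1).+1.
have md : d^-1 < m%:R by exact: truncnS_gt.
exists m => // T P v; pose fr t : RR := t - (Num.floor t)%:~R.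
have fr0 t : 0 <= fr t by rewrite subr_ge0 floor_le.
have fr1 t : fr t < 1 by have := floor_itv t; rewrite intrD /fr; lra.
exists (fun x => Num.truncn (fr (v x) * m%:R)) => [x _|x y _ _ e].
  by rewrite truncn_lt_nat ?mulr_ge0 // gtr_pMl // ltr0n.
have hx := truncn_itv (mulr_ge0 (fr0 (v x)) (ler0n RR m)).
have hy := truncn_itv (mulr_ge0 (fr0 (v y)) (ler0n RR m)).
rewrite e in hx.
have m0 : 0 < m%:R :> RR by rewrite ltr0n.
apply: le_trans (nrm_le _ (Num.floor (v x) - Num.floor (v y))) _.
have -> : v x - v y - (Num.floor (v x) - Num.floor (v y))%:~R = fr (v x) - fr (v y).
  by rewrite intrB /fr; ring.
move: hx hy; rewrite -natr1; set k := (Num.truncn _)%:R => /andP[h1 h2] /andP[h3 h4].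
have md1 : d^-1 * d < m%:R * d by rewrite ltr_pM2r.
rewrite mulVf ?lt0r_neq0 // in md1.
by rewrite ler_norml; apply/andP; split; rewrite -(ler_pM2r m0); nra.
Qed.

(* Closeness on [S] extends to [D] at the cost of the values on the translates. *)
Lemma colored_extend (d : RR) : 0 < d -> exists2 m, (0 < m)%N &
  forall (V : zmodType) (T : Type) (P : T -> Prop) (phi : T -> V -> RR) (n : nat)
    (S D : V -> Prop) (tr : seq V), (forall i, P i -> is_mod1 (phi i)) ->
  colored n P (fun i j => forall s, S s -> nrm (phi i s - phi j s) <= d) ->
  (forall x, D x -> exists2 t, t \in tr & S (x - t)) ->
  colored (n * m ^ size tr) P (fun i j => forall x, D x -> nrm (phi i x - phi j x) <= d *+ 2).
Proof.
move=> d0; have [m m0 colm] := colored_value d0; exists m => // V T P phi n S D tr phiP coln DP.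
have := colored_all (fun k : 'I_(size tr) => colm T P (fun i => phi i tr`_k)).
rewrite card_ord => /(colored_and coln).
apply: colored_sub => // i j Pi Pj [nS ntr] x /DP[t ttr Sxt].
have hD := is_mod1_sub (phiP _ Pi) (phiP _ Pj).
rewrite -(subrK t x) (nrm_mod1D hD) mulr2n.
apply: le_trans (nrmD _ _) (lerD (nS _ Sxt) _).
have := ntr (Ordinal (etrans (index_mem t tr) ttr)); by rewrite /= nth_index.
Qed.

End CharacterColorings.

(** * Almost invariant sets and the large spectrum *)

Section FiniteSums.
Local Open Scope fset_scope.
Local Open Scope ring_scope.
Variables (RR : realType).

Lemma cauchy_schwarz_sum (T : Type) (s : seq T) (F : T -> RR) :
  (\sum_(x <- s) F x) ^+ 2 <= (size s)%:R * \sum_(x <- s) F x ^+ 2.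
Proof.
elim: s => [|a s IH]; first by rewrite !big_nil mul0r expr0n.
rewrite !big_cons /=; set S := \sum_(_ <- _) _ in IH *; set Q := \sum_(_ <- _) _ in IH *.
have Q0 : 0 <= Q by apply: sumr_ge0 => x _; exact: sqr_ge0.
rewrite -natr1; move: (size s) IH => [|n] IH.
  have : S ^+ 2 <= 0 by move: IH; rewrite mul0r.
  by move: Q0; nra.
set k : RR := n.+1%:R in IH *.
have k0 : 0 < k by rewrite ltr0n.
have h := sqr_ge0 (k * F a - S).
have : k * (F a * S *+ 2) <= k * (k * F a ^+ 2 + Q) by move: h IH; nra.
rewrite ler_pM2l //; nra.
Qed.

Section FSets.
Variable V : zmodType.
Implicit Types (A B U X : {fset V}) (f g : V).

Lemma sum_indicator U A : A `<=` U -> \sum_(x <- U) (x \in A)%:R = #|` A|%:R :> RR.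
Proof.
move=> AU; rewrite -(big_fset_incl _ AU) => [|x _ /negbTE -> //].
by rewrite card_fset_sum1 natr_sum !big_seq; apply: eq_bigr => x ->.
Qed.

(** Second moment: Cauchy-Schwarz for the number of sets [A i] that contain a given point of [U]. If
    all overlaps of distinct sets were below [t], the second moment would be at most n b + n^2 t. *)
Lemma overlap (n : nat) U (A : 'I_n -> {fset V}) (a b t : RR) : 0 <= a ->
  (forall i, A i `<=` U) -> (forall i, a <= #|` A i|%:R <= b) ->
  #|` U|%:R * (n%:R * b + n%:R ^+ 2 * t) < (n%:R * a) ^+ 2 ->
  0 <= t ->
  exists i j, i != j /\ t <= #|` A i `&` A j|%:R.
Proof.
move=> a0 AU Aab big t0; apply: contrapT => no.
have small i j : i != j -> #|` A i `&` A j|%:R <= t :> RR.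
  move=> ij; rewrite leNgt; apply/negP => lt; apply: no; exists i, j; split=> //; exact: ltW.
pose F x : RR := \sum_i (x \in A i)%:R.
have := cauchy_schwarz_sum (enum_fset U) F.
have -> : \sum_(x <- U) F x = \sum_i #|` A i|%:R.
  by rewrite exchange_big /=; apply: eq_bigr => i _; rewrite sum_indicator.
have -> : \sum_(x <- U) F x ^+ 2 = \sum_i \sum_j #|` A i `&` A j|%:R.
  under eq_bigr => x _ do rewrite expr2 mulr_suml; rewrite exchange_big /=.
  apply: eq_bigr => i _; under eq_bigr => x _ do rewrite mulr_sumr; rewrite exchange_big /=.
  apply: eq_bigr => j _; rewrite -(@sum_indicator U); last exact: fsubset_trans (fsubsetIl _ _) (AU i).
  by apply: eq_bigr => x _; rewrite in_fsetI -natrM mulnb.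
apply/negP; rewrite -ltNge; apply: le_lt_trans (lt_le_trans big _).
  rewrite ler_wpM2l //.
  have -> : n%:R * b + n%:R ^+ 2 * t = \sum_(i < n) (b + \sum_(j < n) t).
    by rewrite sumr_const card_ord sumr_const card_ord -(mulr_natl t) -(mulr_natl (b + _)); ring.
  apply: ler_sum => i _; rewrite (bigD1 i) //= fsetIid lerD //; first by case/andP: (Aab i).
  rewrite [leRHS](bigD1 i) //= -[leLHS]add0r lerD //.
  by apply: ler_sum => j ji; rewrite small // eq_sym.
rewrite ler_sqr ?nnegrE ?mulr_ge0 ?sumr_ge0 //.
rewrite -[n in n%:R * a]card_ord mulr_natl -sumr_const.
by apply: ler_sum => i _; case/andP: (Aab i).
Qed.

Definition shift g A : {fset V} := [fset x + g | x in A].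
Definition sumset A B : {fset V} := [fset x + y | x in A, y in B].

Lemma in_shift g A x : (x \in shift g A) = (x - g \in A).
Proof.
apply/imfsetP/idP => [[y yA ->]|xA]; first by rewrite addrK.
by exists (x - g) => //; rewrite subrK.
Qed.

Lemma card_shift g A : #|` shift g A| = #|` A|.
Proof. by rewrite card_imfset //; exact: addIr. Qed.

Lemma sumsetP A B z : reflect (exists x y, [/\ x \in A, y \in B & z = x + y]) (z \in sumset A B).
Proof.
apply: (iffP idP) => [/imfset2P[/= x xA [y yB ->]]|[x [y [xA yB ->]]]]; first by exists x, y.
by apply/imfset2P; exists x => //=; exists y.
Qed.

Lemma card_shiftI A f g :
  #|` shift f A `&` shift g A| = #|` A `&` shift (f - g) A|.
Proof.
rewrite -(card_shift (- g) (_ `&` _)) fsetIC; congr #|` _|.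
apply/fsetP => x; rewrite in_shift !in_fsetI !in_shift opprK addrK.
by rewrite -addrA opprB [g - f]addrC.
Qed.

Lemma card_shiftIN A g : #|` A `&` shift (- g) A| = #|` A `&` shift g A|.
Proof.
rewrite -[- g]sub0r -card_shiftI fsetIC card_shiftI subr0 //.
Qed.

Lemma sumset_translate A B b : b \in B -> shift b A `<=` sumset A B.
Proof.
move=> bB; apply/fsubsetP => x; rewrite in_shift => xA.
by apply/sumsetP; exists (x - b), b; rewrite subrK.
Qed.

Lemma sumsetS A A' B B' : A `<=` A' -> B `<=` B' -> sumset A B `<=` sumset A' B'.
Proof.
move=> /fsubsetP AA /fsubsetP BB; apply/fsubsetP => z /sumsetP[x [y [xA yB ->]]].
by apply/sumsetP; exists x, y; split; [exact: AA | exact: BB |].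
Qed.

Definition almost_invariant (h : RR) A g := (1 - h) * #|` A|%:R <= #|` A `&` shift g A|%:R.

End FSets.
End FiniteSums.

Section Smoothing.
Local Open Scope fset_scope.
Local Open Scope ring_scope.
Variable RR : realType.

(** The part of X that [B] still fills after [i] shrinking steps in [almost_invariant_sumset]: one
    use of [translates_overlap] turns density a into a^2 / (2 K). *)
Fixpoint density (K : RR) (i : nat) : RR :=
  if i is j.+1 then density K j ^+ 2 / (2 * K) else 1.

Lemma densityP (K : RR) i : 1 <= K -> [/\ 0 < density K i, density K i <= 1 &
  density K i.+1 <= density K i].
Proof.
move=> K1.
have step t : 0 < t <= 1 -> 0 < t ^+ 2 / (2 * K) <= t.
  move=> /andP[t0 t1]; rewrite divr_gt0 ?exprn_gt0 ?mulr_gt0 //=; last by lra.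
  by rewrite ler_pdivrMr; [nra | lra].
elim: i => [|i [h1 h2 h3]] /=; first by have := step 1; rewrite ltr01 lexx => /(_ isT)/andP[].
have /andP[p1 p2] := step _ (introT andP (conj h1 h2)).
have p3 : density K i ^+ 2 / (2 * K) <= 1 by lra.
by split=> //; have /andP[] := step _ (introT andP (conj p1 p3)).
Qed.

Lemma translates_overlap (K a : RR) (n : nat) (V : zmodType) (X B : {fset V}) (f : 'I_n -> V) :
  1 <= K -> 0 < a -> 2 * K < n%:R * a ^+ 2 -> 0 < #|` X|%:R :> RR ->
  #|` sumset X X|%:R <= K * #|` X|%:R -> B `<=` X -> a * #|` X|%:R <= #|` B|%:R ->
  (forall i, f i \in X) ->
  exists i j, i != j /\ a ^+ 2 / (2 * K) * #|` X|%:R <= #|` B `&` shift (f i - f j) B|%:R.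
Proof.
move=> K1 a0 na; set x : RR := #|` X|%:R => x0 XX BX Ba fX.
have t0 : 0 <= a ^+ 2 / (2 * K) by rewrite divr_ge0 ?exprn_ge0 ?ltW //; lra.
have x0' : 0 <= x by exact: ltW.
have Bx : #|` B|%:R <= x by rewrite ler_nat fsubset_leq_card.
have n0 : 0 < n%:R :> RR.
  rewrite ltr0n lt0n; apply/eqP => n0; move: na; rewrite n0 mul0r; lra.
have [|j|j|||j [k [jk hjk]]] := @overlap RR V n (sumset X X) (fun j => shift (f j) B)
    (a * x) x (a ^+ 2 / (2 * K) * x).
- by rewrite mulr_ge0 // ltW.
- apply/fsubsetP => y; rewrite in_shift => yB; apply/sumsetP.
  by exists (f j), (y - f j); split; [exact: fX | exact: (fsubsetP BX) | rewrite addrC subrK].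
- by rewrite card_shift Ba Bx.
- apply: le_lt_trans (_ : K * x * (n%:R * x + n%:R ^+ 2 * (a ^+ 2 / (2 * K) * x)) < _).
    rewrite ler_wpM2r //; apply: addr_ge0; first exact: mulr_ge0.
    by apply: mulr_ge0; [exact: exprn_ge0 | apply: mulr_ge0].
  have -> : K * x * (n%:R * x + n%:R ^+ 2 * (a ^+ 2 / (2 * K) * x)) =
     n%:R * x ^+ 2 * (K + n%:R * a ^+ 2 / 2) by field; lra.
  have -> : (n%:R * (a * x)) ^+ 2 = n%:R * x ^+ 2 * (n%:R * a ^+ 2) by ring.
  rewrite ltr_pM2l; last by apply: mulr_gt0 => //; exact: exprn_gt0.
  lra.
- exact: mulr_ge0.
by exists j, k; split=> //; move: hjk; rewrite card_shiftI.
Qed.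

(* Sanders' argument: among sumsets [X + B] with [B] shrinking to intersections
   [B n (B + g)], one must be nearly as large as its successors. *)
Lemma almost_invariant_sumset (K h : RR) : 1 <= K -> 0 < h -> h < 1 ->
  exists n, forall (V : zmodType) (X : {fset V}), 0 \in X ->
    #|` sumset X X|%:R <= K * #|` X|%:R ->
    exists Z b, [/\ shift b X `<=` Z, #|` Z|%:R <= K * #|` X|%:R &
      forall f : 'I_n -> V, (forall i, f i \in X) ->
        exists i j, i != j /\ almost_invariant h Z (f i - f j)].
Proof.
move=> K1 h0 h1; pose t := density K.
(* Each failed step multiplies |X + B| by less than 1 - h, starting from at most K |X|, while X + B
   never has fewer than |X| elements. By Bernoulli's inequality [N] failures are impossible once N h
   > K. *)
pose N := (Num.truncn (K / h)).+1.
have t0 i : 0 < t i by have [] := densityP i K1.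
have t0' i : 0 <= t i by exact: ltW.
have tN := t0 N.
have tle i : (i <= N)%N -> t N <= t i.
  move=> iN; rewrite -(subnK iN); elim: (N - i)%N => // k IH.
  by rewrite addSn; apply: le_trans IH; have [] := densityP (k + i) K1.
pose n := (Num.truncn (2 * K / t N ^+ 2)).+1.
exists n => V X X0 XX; set x : RR := #|` X|%:R in XX *.
have x0 : 0 < x by rewrite ltr0n cardfs_gt0; apply/fset0Pn; exists 0.
pose good := exists i B, [/\ (i <= N)%N, B `<=` X, t i * x <= #|` B|%:R &
  forall g, t i.+1 * x <= #|` B `&` shift g B|%:R -> almost_invariant h (sumset X B) g].
have [[i [B [iN BX Bt inv]]]|nogood] := pselect good.
  have [b bB] : exists b, b \in B.
    by apply/fset0Pn; rewrite -cardfs_gt0 -(ltr0n RR); apply: lt_le_trans Bt; rewrite mulr_gt0.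
  exists (sumset X B), b; split; first exact: sumset_translate.
    by apply: le_trans XX; rewrite ler_nat; apply/fsubset_leq_card/sumsetS.
  move=> f fX.
  have [|j [k [jk hjk]]] := translates_overlap K1 (t0 i) _ x0 XX BX Bt fX.
    have : 2 * K < n%:R * t N ^+ 2 by rewrite -ltr_pdivrMr ?exprn_gt0 // truncnS_gt.
    have : n%:R * t N ^+ 2 <= n%:R * t i ^+ 2.
      by apply: ler_wpM2l => //; apply: lerXn2r; rewrite ?nnegrE ?tle.
    lra.
  by exists j, k; split=> //; exact: inv.
exfalso.
have key i : (i <= N)%N -> exists B, [/\ B `<=` X, t i * x <= #|` B|%:R &
    #|` sumset X B|%:R <= (1 - h) ^+ i * K * x].
  elim: i => [_|i IH iN]; first by exists X; rewrite fsubset_refl expr0 !mul1r.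
  have [B [BX Bt BK]] := IH (ltnW iN).
  have [g [gB ng]] : exists g, t i.+1 * x <= #|` B `&` shift g B|%:R /\
      ~ almost_invariant h (sumset X B) g.
    apply: contrapT => nog; apply: nogood; exists i, B; split=> //; first exact: ltnW.
    by move=> g hg; apply: contrapT => ng; apply: nog; exists g.
  exists (B `&` shift g B); split=> //; first exact: fsubset_trans (fsubsetIl _ _) BX.
  (* The sumset of X with the intersection of B and B + g lies in X + B and also in its translate by
     g. *)
  apply: (@le_trans _ _ #|` sumset X B `&` shift g (sumset X B)|%:R).
    rewrite ler_nat; apply/fsubset_leq_card/fsubsetP => y /sumsetP[u [v [uX]]].
    rewrite in_fsetI in_shift => /andP[vB vgB] ->.
    rewrite in_fsetI in_shift; apply/andP; split; apply/sumsetP; first by exists u, v.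
    by exists u, (v - g); rewrite addrA.
  have /ltW h2 : #|` sumset X B `&` shift g (sumset X B)|%:R < (1 - h) * #|` sumset X B|%:R.
    by rewrite ltNge; apply/negP.
  apply: le_trans h2 _; rewrite exprS -2!mulrA; apply: ler_wpM2l; first by rewrite subr_ge0 ltW.
  by rewrite mulrA.
have [B [BX Bt BK]] := key N (leqnn N).
have [b bB] : exists b, b \in B.
  by apply/fset0Pn; rewrite -cardfs_gt0 -(ltr0n RR); apply: lt_le_trans Bt; rewrite mulr_gt0.
have xB : x <= #|` sumset X B|%:R.
  by rewrite /x -(card_shift b X) ler_nat; apply/fsubset_leq_card/sumset_translate.
have bern k : (1 - h) ^+ k * (1 + k%:R * h) <= 1.
  elim: k => [|k IH]; first by rewrite expr0 mul0r addr0 mulr1.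
  apply: le_trans IH; rewrite exprSr -mulrA; apply: ler_wpM2l; first by rewrite exprn_ge0 // subr_ge0 ltW.
  rewrite -natr1; have : 0 <= k%:R :> RR by []. 
  by move: h0; nra.
have Nh : K < N%:R * h by rewrite -ltr_pdivrMr // truncnS_gt.
have : 1 <= (1 - h) ^+ N * K.
  by rewrite -(ler_pM2r x0) mul1r; apply: le_trans BK.
have := bern N; have : 0 < (1 - h) ^+ N by rewrite exprn_gt0 // subr_gt0.
nra.
Qed.

End Smoothing.

(** * Total boundedness of the large spectrum *)

Section Spectrum.
Local Open Scope fset_scope.
Local Open Scope ring_scope.
Variable RR : realType.

Section Almost.
Variable V : zmodType.
Implicit Types (A U X Z : {fset V}) (F : V -> RR).

Lemma sum_subset U A F : A `<=` U -> \sum_(x <- U) F x * (x \in A)%:R = \sum_(x <- A) F x.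
Proof.
move=> AU; rewrite -(big_fset_incl _ AU) => [|x _ /negbTE ->]; last by rewrite mulr0.
by rewrite !big_seq; apply: eq_bigr => x ->; rewrite mulr1.
Qed.

Lemma sum_shift A F g : \sum_(x <- shift g A) F x = \sum_(x <- A) F (x + g).
Proof. by rewrite big_imfset //= => x y _ _; exact: addIr. Qed.

(** The symmetric difference of Z and its translate has at most 2 h |Z| points. *)
Lemma almost_invariant_sum Z F h g : (forall x, `|F x| <= 1) -> almost_invariant h Z g ->
  `|\sum_(z <- Z) F z - \sum_(z <- Z) F (z + g)| <= 2 * h * #|` Z|%:R.
Proof.
move=> F1 inv; rewrite -sum_shift; set Z' := shift g Z.
rewrite -(sum_subset F (fsubsetUl Z Z')) -(sum_subset F (fsubsetUr Z Z')) -sumrB.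
apply: le_trans (ler_norm_sum _ _ _) _.
apply: (@le_trans _ _ (\sum_(x <- Z `|` Z') ((x \in Z)%:R + (x \in Z')%:R - 2 * (x \in Z `&` Z')%:R))).
  apply: ler_sum => x _; rewrite -mulrBr normrM in_fsetI.
  apply: le_trans (ler_wpM2r (normr_ge0 _) (F1 x)) _; rewrite mul1r.
  by case: (x \in Z); case: (x \in Z') => /=; rewrite ?subrr ?subr0 ?sub0r ?normrN ?normr0 ?normr1; lra.
rewrite sumrB big_split /= -mulr_sumr !sum_indicator ?fsubsetUl ?fsubsetUr //; last first.
  by apply: fsubset_trans (fsubsetIl _ _) (fsubsetUl _ _).
by rewrite card_shift; move: inv; rewrite /almost_invariant -/Z'; lra.
Qed.

(** Approximate version of [sum_cos1_shift]: the vector of cosine and sine sums is almost fixed by a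
    rotation whose angle is bounded away from 0. *)
Lemma invariant_cos1_sum Z (w : V -> RR) c h e g : is_mod1 w -> almost_invariant h Z g ->
  cos1 (w g) <= 1 - e -> `|\sum_(z <- Z) cos1 (w z - c)| * e <= 3 * h * #|` Z|%:R.
Proof.
move=> wD inv far; set C := \sum_(z <- Z) _; pose S := \sum_(z <- Z) sin1 (w z - c).
have e1 z : w (z + g) - c - ((w z - c) + w g) \is a Num.int.
  by have := wD z g; congr (_ \is a Num.int); ring.
have := @almost_invariant_sum Z (fun z => cos1 (w z - c)) h g (fun=> norm_cos1 _) inv.
have := @almost_invariant_sum Z (fun z => sin1 (w z - c)) h g (fun=> norm_sin1 _) inv.
rewrite -/C -/S.
have -> : \sum_(z <- Z) cos1 (w (z + g) - c) = C * cos1 (w g) - S * sin1 (w g).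
  by rewrite !mulr_suml -sumrB; apply: eq_bigr => z _; rewrite (cos1_eqz (e1 z)) cos1D.
have -> : \sum_(z <- Z) sin1 (w (z + g) - c) = S * cos1 (w g) + C * sin1 (w g).
  by rewrite !mulr_suml -big_split; apply: eq_bigr => z _; rewrite (sin1_eqz (e1 z)) sin1D.
set k := cos1 (w g) in far *; set s := sin1 (w g); set B := 2 * h * _ => hS hC.
have ks : k ^+ 2 + s ^+ 2 = 1 by exact: cos1sin1.
have eq : C * (2 * (1 - k)) = (C - (C * k - S * s)) * (1 - k) - (S - (S * k + C * s)) * s.
  have -> : C * (2 * (1 - k)) = C * (1 - k) * 2 + C * (k ^+ 2 + s ^+ 2 - 1) by rewrite ks; ring.
  by ring.
have k1 : -1 <= k by exact: cos1_geN1.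
have bound : `|C| * (2 * (1 - k)) <= B * 3.
  have -> : `|C| * (2 * (1 - k)) = `|C * (2 * (1 - k))|.
    have k1' : k <= 1 by exact: cos1_le1.
    by rewrite normrM (@ger0_norm _ (2 * _)) //; lra.
  rewrite eq; apply: le_trans (ler_normB _ _) _; rewrite !normrM.
  have -> : B * 3 = B * 2 + B * 1 by ring.
  apply: lerD; apply: ler_pM => //; last exact: norm_sin1.
  by rewrite ler_norml; have := cos1_le1 (w g); rewrite -/k; lra.
have := ler_wpM2l (normr_ge0 C) far; move: bound; rewrite /B; nra.
Qed.

(* Bessel's inequality for the [cos1 (f i)] in L^2(Z). *)
Lemma spectrum_bessel (n : nat) X Z b (f : 'I_n -> V -> RR) (K e d : RR) : 0 <= e -> 0 <= d ->
  (forall i, is_mod1 (f i)) -> shift b X `<=` Z -> 0 < #|` X|%:R :> RR ->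
  #|` Z|%:R <= K * #|` X|%:R ->
  (forall i, e * #|` X|%:R <= `|\sum_(x <- X) cos1 (f i x)|) ->
  (forall i j, i != j ->
     `|\sum_(z <- Z) cos1 (f i z - f j z - (f i b - f j b))| <= d * #|` Z|%:R) ->
  n%:R ^+ 2 * e ^+ 2 <= K * (n%:R + n%:R ^+ 2 * d).
Proof.
move=> e0 d0 fD bXZ x0 ZK spec off; set x : RR := #|` X|%:R in x0 ZK spec *.
pose S i := \sum_(x <- X) cos1 (f i x).
(* The signs make every term of the pairing with X + b nonnegative, and the phases [f i b] recentre
   that translate. [Fs] is the imaginary part: in the sum of both squares only the differences of
   [f i] and [f j] survive. *)
pose u i : RR := Num.sg (S i).
have u1 i : `|u i| <= 1 by rewrite normr_sg; case: (S i != 0).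
pose Fc z := \sum_i u i * cos1 (f i z - f i b).
pose Fs z := \sum_i u i * sin1 (f i z - f i b).
have sumFc : \sum_(z <- X) Fc (z + b) = \sum_i `|S i|.
  rewrite exchange_big /=; apply: eq_bigr => i _; rewrite -mulr_sumr (normrEsg (S i)); congr (_ * _).
  by apply: eq_bigr => z _; apply: cos1_eqz; have := fD i z b; congr (_ \is a Num.int); ring.
have low : n%:R * (e * x) <= \sum_(z <- X) Fc (z + b).
  rewrite sumFc -[n in n%:R * _]card_ord mulr_natl -sumr_const.
  by apply: ler_sum => i _; exact: spec.
have FcFs z : Fc z ^+ 2 + Fs z ^+ 2 =
    \sum_i \sum_j u i * u j * cos1 (f i z - f j z - (f i b - f j b)).
  rewrite !expr2 !mulr_suml -big_split /=; apply: eq_bigr => i _.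
  rewrite !mulr_sumr -big_split /=; apply: eq_bigr => j _.
  have -> : f i z - f j z - (f i b - f j b) = (f i z - f i b) + - (f j z - f j b) by ring.
  by rewrite [in RHS]cos1D cos1N sin1N; ring.
have Q0 z : 0 <= Fc z ^+ 2 + Fs z ^+ 2 by rewrite addr_ge0 ?sqr_ge0.
have up : \sum_(z <- X) Fc (z + b) ^+ 2 <= \sum_(z <- Z) (Fc z ^+ 2 + Fs z ^+ 2).
  apply: (@le_trans _ _ (\sum_(z <- X) (Fc (z + b) ^+ 2 + Fs (z + b) ^+ 2))).
    by apply: ler_sum => z _; rewrite lerDl sqr_ge0.
  rewrite -(sum_shift X (fun z => Fc z ^+ 2 + Fs z ^+ 2)) -(sum_subset _ bXZ).
  by apply: ler_sum => z _; case: (z \in _); rewrite ?mulr1 ?mulr0.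
have up2 : \sum_(z <- Z) (Fc z ^+ 2 + Fs z ^+ 2) <= (n%:R + n%:R ^+ 2 * d) * #|` Z|%:R.
  under eq_bigr => z _ do rewrite FcFs.
  rewrite exchange_big /=.
  have -> : (n%:R + n%:R ^+ 2 * d) * #|` Z|%:R = \sum_(i < n) (#|` Z|%:R + \sum_(j < n) d * #|` Z|%:R).
    by rewrite sumr_const card_ord sumr_const card_ord -(mulr_natl (d * _)) -(mulr_natl (_ + _)); ring.
  apply: ler_sum => i _; rewrite exchange_big /= (bigD1 i) //=; apply: lerD.
    apply: le_trans (_ : \sum_(z <- Z) 1 <= _); last by rewrite card_fset_sum1 natr_sum.
    apply: ler_sum => z _; rewrite subrr subrr subr0 cos1_0 mulr1.
    by have := u1 i; rewrite ler_norml => /andP[]; nra.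
  rewrite [leRHS](bigD1 i) //= -[leLHS]add0r; apply: lerD; first by rewrite mulr_ge0.
  apply: ler_sum => j ji; rewrite -mulr_sumr; apply: le_trans (ler_norm _) _.
  rewrite normrM -[leRHS]mul1r; apply: ler_pM => //; last by apply: off; rewrite eq_sym.
  by rewrite normrM -[1]mulr1; apply: ler_pM.
have cs := cauchy_schwarz_sum (enum_fset X) (fun z => Fc (z + b)).
have nex : 0 <= n%:R * (e * x) by rewrite !mulr_ge0 // ltW.
have sq : (n%:R * (e * x)) ^+ 2 <= (\sum_(z <- X) Fc (z + b)) ^+ 2.
  by apply: lerXn2r => //; rewrite nnegrE //; apply: le_trans low.
rewrite -(ler_pM2r (exprn_gt0 2 x0)).
have -> : n%:R ^+ 2 * e ^+ 2 * x ^+ 2 = (n%:R * (e * x)) ^+ 2 by ring.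
apply: le_trans sq (le_trans cs _); rewrite -/x.
have -> : K * (n%:R + n%:R ^+ 2 * d) * x ^+ 2 = x * ((n%:R + n%:R ^+ 2 * d) * (K * x)) by ring.
apply: ler_wpM2l; first exact: ltW.
apply: le_trans up (le_trans up2 _); apply: ler_wpM2l => //.
by rewrite addr_ge0 // mulr_ge0 // exprn_ge0.
Qed.

End Almost.

(** If every two of the characters were far apart at some almost period of Z, their cosines would be
    nearly orthogonal on Z and Bessel would bound their number. [h] keeps K times the off-diagonal
    bound below e^2 / 2, and n > 2 K / e^2 contradicts what the diagonal leaves. *)
Lemma spectrum_packing (K e d : RR) : 1 <= K -> 0 < e -> 0 < d -> d <= 2^-1 ->
  exists (h : RR) (n : nat), [/\ 0 < h, h < 1 & forall (V : zmodType) (X Z : {fset V}) b,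
    0 \in X -> shift b X `<=` Z -> #|` Z|%:R <= K * #|` X|%:R ->
    forall f : 'I_n -> V -> RR,
      (forall i, is_mod1 (f i) /\ e * #|` X|%:R <= `|\sum_(x <- X) cos1 (f i x)|) ->
      exists i j, i != j /\ forall y, almost_invariant h Z y -> nrm (f i y - f j y) <= d].
Proof.
move=> K1 e0 d0 d2; have [r r0 far] := cos1_far d0 d2.
pose h := Num.min 2^-1 (r * e ^+ 2 / (6 * K)).
have h0 : 0 < h by rewrite lt_min invr_gt0 ltr0n /= divr_gt0 ?mulr_gt0 ?exprn_gt0 //; lra.
have h1 : h < 1 by rewrite /h gt_min; apply/orP; left; lra.
pose n := (Num.truncn (2 * K / e ^+ 2)).+1.
exists h, n; split=> // V X Z b X0 bXZ ZK f fP.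
have x0 : 0 < #|` X|%:R :> RR by rewrite ltr0n cardfs_gt0; apply/fset0Pn; exists 0.
apply: contrapT => no.
have off i j : i != j ->
    `|\sum_(z <- Z) cos1 (f i z - f j z - (f i b - f j b))| <= 3 * h / r * #|` Z|%:R.
  move=> ij.
  have [y inv ny] : exists2 y, almost_invariant h Z y & ~ nrm (f i y - f j y) <= d.
    apply: contrapT => ny; apply: no; exists i, j; split=> // y inv.
    by apply: contrapT => nf; apply: ny; exists y.
  have /ltW/far far' : d < nrm (f i y - f j y) by rewrite ltNge; apply/negP.
  have := invariant_cos1_sum (f i b - f j b) (is_mod1_sub (fP i).1 (fP j).1) inv far'.
  by move=> hh; rewrite [leRHS]mulrAC ler_pdivlMr.
have := spectrum_bessel (ltW e0) _ (fun i => (fP i).1) bXZ x0 ZK (fun i => (fP i).2) off.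
have hr : K * (3 * h / r) <= e ^+ 2 / 2.
  have hh : h <= r * e ^+ 2 / (6 * K) by rewrite /h ge_min lexx orbT.
  rewrite ler_pdivlMr in hh; last by lra.
  by rewrite !mulrA ler_pdivrMr //; lra.
have n0 : 0 < n%:R :> RR by rewrite ltr0n.
have ne : 2 * K < n%:R * e ^+ 2 by rewrite -ltr_pdivrMr ?exprn_gt0 // truncnS_gt.
have dr : 0 <= 3 * h / r by rewrite divr_ge0 ?mulr_ge0 // ltW.
move=> /(_ dr).
apply/negP; rewrite -ltNge.
have -> : K * (n%:R + n%:R ^+ 2 * (3 * h / r)) = n%:R * (K + n%:R * (K * (3 * h / r))) by ring.
have -> : n%:R ^+ 2 * e ^+ 2 = n%:R * (n%:R * e ^+ 2) by ring.
rewrite ltr_pM2l //.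
have := ler_wpM2l (ltW n0) hr; lra.
Qed.

(** The packing bound yields a net of the spectrum for closeness at the almost periods of Z.
    Boundedly many translates of these cover X, so [colored_extend] gives closeness on X. Passing
    from net to coloring doubles the distance, and so does the extension, hence the start from d /
    4. *)
Lemma spectrum_colored (K e d : RR) : 1 <= K -> 0 < e -> 0 < d ->
  exists n, forall (V : zmodType) (X : {fset V}), 0 \in X ->
    #|` sumset X X|%:R <= K * #|` X|%:R ->
    colored n (fun t : V -> RR => is_mod1 t /\ e * #|` X|%:R <= `|\sum_(x <- X) cos1 (t x)|)
      (fun t u => forall x, x \in X -> nrm (t x - u x) <= d).
Proof.
move=> K1 e0 d0; pose d' := Num.min 2^-1 (d / 4).
have d'0 : 0 < d' by rewrite lt_min invr_gt0 ltr0n divr_gt0.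
have d'2 : d' <= 2^-1 by rewrite ge_min lexx.
have d'd : d' *+ 2 <= d / 2.
  have : d' <= d / 4 by rewrite /d' ge_min lexx orbT.
  by rewrite -mulr_natr; lra.
have [h [n [h0 h1 pack]]] := spectrum_packing K1 e0 d'0 d'2.
have [n' smooth] := almost_invariant_sumset K1 h0 h1.
have d20 : 0 < d / 2 by lra.
have [m m0 ext] := colored_extend d20.
exists (n * m ^ n')%N => V X X0 XX.
have [Z [b [bXZ ZK packX]]] := smooth V X X0 XX.
have [|k [r [kn' rX rcov]]] := @packing_net _ n' (fun x => x \in X)
    (fun x y => almost_invariant h Z (x - y)) _ packX.
  by move=> x y; rewrite /almost_invariant -card_shiftIN opprB.
pose P (t : V -> RR) := is_mod1 t /\ e * #|` X|%:R <= `|\sum_(x <- X) cos1 (t x)|.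
pose close c (t u : V -> RR) := forall y, almost_invariant h Z y -> nrm (t y - u y) <= c.
have [|k2 [r2 [k2n r2X r2cov]]] := @packing_net _ n P (close d') _ (pack V X Z b X0 bXZ ZK).
  by move=> t u tu y /tu; rewrite -nrmN opprB.
have col : colored k2 P (close (d / 2)).
  apply: net_colored r2cov _ => t u i _ _ ti ui y inv; apply: le_trans d'd; rewrite mulr2n.
  have -> : t y - u y = (t y - r2 i y) - (u y - r2 i y) by ring.
  by apply: le_trans (nrmB _ _) _; apply: lerD; [exact: ti | exact: ui].
have cov x : x \in X -> exists2 t, t \in [seq r i | i <- enum 'I_k] & almost_invariant h Z (x - t).
  by move=> /rcov[i xi]; exists (r i) => //; apply: map_f; rewrite mem_enum.
have := ext V _ P id k2 _ _ _ (fun i => @proj1 _ _) col cov.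
have le : (k2 * m ^ size [seq r i | i <- enum 'I_k] <= n * m ^ n')%N.
  rewrite size_map size_enum_ord; apply: leq_mul; first exact: ltnW.
  by apply: leq_pexp2l => //; exact: ltnW.
move=> /(colored_le le).
apply: colored_sub => // t u _ _ tu x /tu/le_trans; apply.
by rewrite mulr2n; lra.
Qed.

End Spectrum.

(** * Successive minima of a submultiplicative norm *)

Section Packaging.
Local Open Scope quotient_scope.
Variable R : rngType.

Lemma subrng_of (P : R -> Prop) : P 0 -> (forall x y, P x -> P y -> P (x - y)) ->
  (forall x y, P x -> P y -> P (x ** y)) ->
  exists S : subrng R, forall x, (x \in (S : {pred R})) <-> P x.
Proof.
move=> P0 PB PM; pose S : {pred R} := fun x => `[< P x >].
have SP x : (x \in S) <-> P x by split=> [/asboolP|?] //; apply/asboolP.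
have S1 : GRing.zmod_closed S by split=> [|x y /SP Px /SP Py]; apply/SP => //; exact: PB.
have S2 : {in S &, forall x y, x ** y \in S} by move=> x y /SP Px /SP Py; apply/SP/PM.
pose m1 := GRing.isZmodClosed.Build R S S1.
pose m2 := isRmulClosed.Build R S S2.
by exists (HB.pack_for (subrng R) (S : R -> bool) m1 m2).
Qed.

Lemma rngIdeal_of (P : R -> Prop) : P 0 -> (forall x y, P x -> P y -> P (x - y)) ->
  (forall a x, P x -> P (a ** x) /\ P (x ** a)) ->
  exists I : rngIdeal R, forall x, (x \in (I : {pred R})) <-> P x.
Proof.
move=> P0 PB PM; pose S : {pred R} := fun x => `[< P x >].
have SP x : (x \in S) <-> P x by split=> [/asboolP|?] //; apply/asboolP.
have S1 : GRing.zmod_closed S by split=> [|x y /SP Px /SP Py]; apply/SP => //; exact: PB.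
have S2 a x : x \in S -> (a ** x \in S) /\ (x ** a \in S).
  by move=> /SP /(PM a)[h1 h2]; split; exact/SP.
pose m1 := GRing.isZmodClosed.Build R S S1.
pose m2 := isRmulAbsorbing.Build R S S2.
by exists (HB.pack_for (rngIdeal R) (S : R -> bool) m1 m2).
Qed.

Lemma rng_quot_nilpotent (I : rngIdeal R) (n : nat) :
  (forall (x : R) (s : n.-tuple R), foldl (@rmul R) x s \in (I : {pred R})) ->
  nilpotent_class_le (rng_quot I) n.
Proof.
move=> h x s.
have piM (y : R) (t : seq (rng_quot I)) :
    foldl (@rmul (rng_quot I)) (\pi_(rng_quot I) y) t =
    \pi_(rng_quot I) (foldl (@rmul R) y (map repr t)).
  elim: t y => //= z t IH y; rewrite -IH; congr foldl.
  by rewrite pi_rng_quot_mul reprK.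
rewrite -[x]reprK piM.
have := h (repr x) [tuple of map repr s]; set y := foldl _ _ _ => yI.
have -> : 0 = \pi_(rng_quot I) 0 by apply: (addrI (\pi_(rng_quot I) 0)); rewrite addr0 -pi_rng_quotD addr0.
by apply/eqP; rewrite -Quotient.idealrBE subr0.
Qed.

End Packaging.

Section Doubling.
Variable RR : realType.

Lemma exp2_unbounded (a d : RR) : 0 < a -> exists q : nat, d < a * 2 ^+ q.
Proof.
move=> a0; exists (Num.truncn (d / a)).+1.
rewrite mulrC -ltr_pdivrMr //; apply: lt_trans (truncnS_gt _) _.
by rewrite -natrX ltr_nat ltn_expl.
Qed.

Lemma dyadic_scale (t d : RR) : 0 < t -> t <= d ->
  exists q : nat, t * 2 ^+ q <= d /\ d < t * 2 ^+ q.+1.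
Proof.
move=> t0 td; have ex : exists q, d < t * 2 ^+ q by exact: exp2_unbounded.
case: (ex_minnP ex) => -[|q] h qmin; first by move: h; rewrite expr0 mulr1 ltNge td.
by exists q; split=> //; rewrite leNgt; apply/negP => /qmin; rewrite ltnn.
Qed.

(** Pick [q] with t 2^q <= d < t 2^(q+1), so that a 2^(q+2) < t 2^(q+1). Of the two spare powers of
    2 in the hypothesis one is lost to this rounding. For t = 0 every [q] is allowed, which forces a
    = 0. *)
Lemma half_of_dyadic (a t d : RR) : 0 <= t -> t <= d -> 0 <= a ->
  (forall q : nat, t * 2 ^+ q <= d -> a * 2 ^+ q.+2 <= d) -> a * 2 <= t.
Proof.
move=> t0 td a0 h; have [t00|tn] := eqVneq t 0.
  rewrite t00 in h *; have [->|an] := eqVneq a 0; first by rewrite mul0r.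
  have ap : 0 < a by rewrite lt_neqAle eq_sym an.
  have [q dq] := exp2_unbounded d ap.
  have : a * 2 ^+ q.+2 <= d by apply: h; rewrite mul0r; exact: le_trans td.
  rewrite !exprS; have : 0 < 2 ^+ q :> RR by exact: exprn_gt0.
  by nra.
have [|q [q1 q2]] := @dyadic_scale t d _ td; first by rewrite lt_neqAle eq_sym tn.
have := h q q1; move: q2; rewrite !exprS.
by have : 0 < 2 ^+ q :> RR by [exact: exprn_gt0]; nra.
Qed.

End Doubling.

Lemma seq_argmin (RR : realDomainType) (T : eqType) (F : T -> RR) (P : T -> Prop) (s : seq T) :
  (exists2 x, x \in s & P x) ->
  exists x, [/\ x \in s, P x & forall y, y \in s -> P y -> F x <= F y].
Proof.
elim: s => [[] //|a s IH] [x xs Px].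
have [ex|nex] := pselect (exists2 x, x \in s & P x); last first.
  have ax : x = a.
    by move: xs; rewrite inE => /orP[/eqP //|xs]; case: nex; exists x.
  exists a; split; [exact: mem_head | by rewrite -ax|].
  by move=> y; rewrite inE => /orP[/eqP -> //|ys Py]; case: nex; exists y.
have [b [bs Pb bmin]] := IH ex.
have [[Pa Fab]|nab] := pselect (P a /\ F a <= F b).
  exists a; split=> //; first exact: mem_head.
  move=> y; rewrite inE => /orP[/eqP -> //|ys Py]; exact: le_trans (bmin _ ys Py).
exists b; split=> //; first by rewrite inE bs orbT.
move=> y; rewrite inE => /orP[/eqP ->|]; last exact: bmin.
by move=> Pa; rewrite leNgt; apply/negP => /ltW ab; apply: nab.
Qed.

Lemma rmulMn (R : rngType) (x y : R) m n : (x *+ m) ** (y *+ n) = (x ** y) *+ (m * n).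
Proof.
have hl z k : (z *+ k) ** (y *+ n) = (z ** (y *+ n)) *+ k.
  by elim: k => [|k IH]; rewrite ?mulr0n ?rmul0r // !mulrS rmulDl IH.
have hr k : x ** (y *+ k) = (x ** y) *+ k.
  by elim: k => [|k IH]; rewrite ?mulr0n ?rmulr0 // !mulrS rmulDr IH.
by rewrite hl hr -mulrnA mulnC.
Qed.

Lemma rmulMzl (R : rngType) (x y : R) (k : int) : (x *~ k) ** y = (x ** y) *~ k.
Proof.
case: (intP k) => [|n|n]; rewrite ?mulr0z ?rmul0r // ?mulrNz ?rmulNl -!pmulrn;
by have := rmulMn x y n.+1 1; rewrite !mulr1n muln1 => ->.
Qed.

Lemma rmulMzr (R : rngType) (x y : R) (k : int) : x ** (y *~ k) = (x ** y) *~ k.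
Proof.
case: (intP k) => [|n|n]; rewrite ?mulr0z ?rmulr0 // ?mulrNz ?rmulNr -!pmulrn;
by have := rmulMn x y 1 n.+1; rewrite !mulr1n mul1n => ->.
Qed.

Section SuccessiveMinima.
Variables (RR : realType) (R : rngType) (M : {fset R}) (N : R -> RR) (r d : RR) (C : nat).
Hypothesis N0 : N 0 = 0.
Hypothesis N_ge0 : forall x, 0 <= N x.
Hypothesis NN : forall x, N (- x) = N x.
Hypothesis ND : forall x y, N (x + y) <= N x + N y.
Hypothesis N2 : forall x, N x <= 4^-1 -> N (x *+ 2) = N x *+ 2.
Hypothesis M0 : 0 \in M.
Hypothesis MN : forall x, x \in M -> - x \in M.
Hypothesis MD : forall x y, x \in M -> y \in M -> N (x + y) <= r -> x + y \in M.
Hypothesis MM : forall x y, x \in M -> y \in M -> N x <= d -> N y <= d ->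
  x ** y \in M /\ N (x ** y) <= d.
Hypotheses (d_gt0 : 0 < d) (d_r : d <= r) (r_small : r <= 8^-1).
Hypothesis packM : forall f : 'I_C -> R, (forall i, f i \in M) ->
  exists i j, i != j /\ N (f i - f j) <= d / 16.

Implicit Types (us vs : seq R) (x y u : R).

Lemma NB x y : N (x - y) <= N x + N y. Proof. by rewrite -(NN y) ND. Qed.

Lemma MB x y : x \in M -> y \in M -> N (x - y) <= r -> x - y \in M.
Proof. by move=> xM /MN yM; exact: MD. Qed.

Lemma N_exp2 x p : (forall i, (i < p)%N -> N (x *+ 2 ^ i) <= 4^-1) -> N (x *+ 2 ^ p) = N x * 2 ^+ p.
Proof.
elim: p => [|p IH] h; first by rewrite expn0 expr0 mulr1 mulr1n.
rewrite expnSr mulrnA N2 ?h // IH; last by move=> i ip; apply: h; exact: ltnW.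
by rewrite exprSr; ring.
Qed.

Lemma exp2_in_ball x p : x \in M -> N x * 2 ^+ p <= d ->
  x *+ 2 ^ p \in M /\ N (x *+ 2 ^ p) = N x * 2 ^+ p.
Proof.
move=> xM; elim: p => [|p IH] h; first by rewrite expn0 expr0 mulr1 mulr1n.
have h2 : N x * 2 ^+ p <= d.
  by apply: le_trans h; rewrite ler_wpM2l // exprS ler_peMl ?exprn_ge0 //; lra.
have [yM yN] := IH h2.
have e : N (x *+ 2 ^ p.+1) = N x * 2 ^+ p.+1.
  rewrite expnSr mulrnA N2; first by rewrite yN exprSr; ring.
  by rewrite yN; apply: le_trans h2 _; move: d_r r_small; lra.
split=> //; rewrite expnSr mulrnA mulr2n; apply: MD => //.
by rewrite -mulr2n -mulrnA -expnSr e; exact: le_trans d_r.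
Qed.

(** For i = a + b, 2^i (xy) is the product of 2^a x and 2^b y, both still in the ball, so its norm
    is at most d. Knowing this for every i <= p + q excludes wrapping around the circle, and the
    norm doubles exactly at each stage. *)
Lemma N_rmul_exp2 x y p q : x \in M -> y \in M -> N x * 2 ^+ p <= d -> N y * 2 ^+ q <= d ->
  N (x ** y) * 2 ^+ (p + q) <= d.
Proof.
move=> xM yM hx hy.
have sub t i k : (i <= k)%N -> 0 <= t -> t * 2 ^+ k <= d -> t * 2 ^+ i <= d.
  move=> ik t0; apply: le_trans; rewrite ler_wpM2l //.
  by apply: ler_weXn2l => //; lra.
have ball i : (i <= p + q)%N -> N ((x ** y) *+ 2 ^ i) <= d.
  move=> ipq; have -> : i = (minn i p + (i - minn i p))%N by lia.
  set a := minn i p; set b := (i - a)%N.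
  have ap : (a <= p)%N by exact: geq_minr.
  have bq : (b <= q)%N by lia.
  have [xaM xaN] := exp2_in_ball xM (sub _ _ _ ap (N_ge0 x) hx).
  have [ybM ybN] := exp2_in_ball yM (sub _ _ _ bq (N_ge0 y) hy).
  rewrite expnD -rmulMn; apply: (MM _ _ _ _).2 => //.
    by rewrite xaN; exact: sub ap _ hx.
  by rewrite ybN; exact: sub bq _ hy.
rewrite -N_exp2; first exact: ball.
move=> i ipq; apply: le_trans (ball i (ltnW ipq)) _; move: d_r r_small; lra.
Qed.

(** The radius d / 4 leaves two doublings within the ball: one pays for dyadic rounding, the other
    makes multiplication by a small element halve norms ([N_contract]). *)
Definition small x := x \in M /\ N x <= d / 4.

Lemma N_contract x y : small x -> y \in M -> N y <= d ->
  [/\ x ** y \in M, y ** x \in M, N (x ** y) * 2 <= N y & N (y ** x) * 2 <= N y].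
Proof.
move=> [xM xd] yM yd.
have xd' : N x <= d by move: d_gt0; lra.
have xd4 : N x * 2 ^+ 2 <= d by rewrite expr2; lra.
split; [exact: (MM _ _ _ _).1 | exact: (MM _ _ _ _).1 | |].
  apply: half_of_dyadic (N_ge0 y) yd (N_ge0 _) _ => q hq.
  exact: (N_rmul_exp2 (p := 2) xM yM xd4 hq).
apply: half_of_dyadic (N_ge0 y) yd (N_ge0 _) _ => q hq.
by have := N_rmul_exp2 yM xM hq xd4; rewrite addn2.
Qed.

(** The recursion ends in H, not in 0: every span contains H, and [span [::]] becomes the ideal. *)
Fixpoint span us x : Prop :=
  if us is u :: us' then exists k : int, span us' (x - u *~ k) else x \in M /\ N x = 0.

Lemma small0 x : x \in M -> N x = 0 -> small x.
Proof. by move=> xM x0; split=> //; rewrite x0; move: d_gt0; lra. Qed.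

Lemma span0 us : span us 0.
Proof. by elim: us => //= u us IH; exists 0; rewrite mulr0z subr0. Qed.

Lemma spanB us x y : span us x -> span us y -> span us (x - y).
Proof.
elim: us x y => [|u us IH] x y /=.
  move=> [xM x0] [yM y0]; have : N (x - y) <= 0 by apply: le_trans (NB _ _) _; rewrite x0 y0 addr0.
  move=> h; split; last by apply/le_anti; rewrite h N_ge0.
  by apply: MB => //; apply: le_trans h _; move: d_gt0 d_r; lra.
move=> [k hk] [l hl]; exists (k - l).
have -> : x - y - u *~ (k - l) = (x - u *~ k) - (y - u *~ l).
  by rewrite mulrzBr !opprB [X in _ - _ + X = _]addrC addrACA [- y + _]addrC.
exact: IH.
Qed.

Lemma spanN us x : span us x -> span us (- x).
Proof. by move=> h; rewrite -sub0r; apply: spanB => //; exact: span0. Qed.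

Lemma spanD us x y : span us x -> span us y -> span us (x + y).
Proof. by move=> hx hy; rewrite -[y]opprK; apply: spanB => //; exact: spanN. Qed.

Lemma spanMz us x (k : int) : span us x -> span us (x *~ k).
Proof.
move=> hx; have hn (n : nat) : span us (x *+ n).
  by elim: n => [|n IH]; rewrite ?mulr0n ?mulrS; [exact: span0 | exact: spanD].
by case: (intP k) => [|n|n]; rewrite ?mulr0z ?mulrNz -?pmulrn; [exact: span0 | | exact: spanN].
Qed.

Lemma span_cons u us x : span us x -> span (u :: us) x.
Proof. by move=> h; exists 0; rewrite mulr0z subr0. Qed.

Lemma span_head u us : span (u :: us) u.
Proof. by exists 1; rewrite mulr1z subrr; exact: span0. Qed.

Lemma span_mem us u : u \in us -> span us u.
Proof.
elim: us => // v us IH; rewrite inE => /orP[/eqP ->|/IH]; first exact: span_head.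
exact: span_cons.
Qed.

Lemma span_nil us x : span [::] x -> span us x.
Proof. by move=> h; elim: us => // u us; exact: span_cons. Qed.

Lemma span_behead us x : span (behead us) x -> span us x.
Proof. by case: us => // u us; exact: span_cons. Qed.

(* Most recent vector first. *)
Fixpoint minima us : Prop :=
  if us is u :: us' then [/\ minima us', small u, ~ span us' u &
    forall w, small w -> ~ span us' w -> N u <= N w] else True.

(** For the top vector [u], the products of [x] and [u] have at most half its norm, so they are
    small and minimality puts them in the span of the earlier vectors; the remaining part is handled
    by induction. When [us] is empty, [behead] changes nothing: small elements multiply H into H. *)
Lemma small_absorb us x y : minima us -> small x -> span us y ->
  span (behead us) (x ** y) /\ span (behead us) (y ** x).
Proof.
elim: us y => [|u us IH] y.
  move=> _ sx [yM y0]; have yd : N y <= d by rewrite y0 ltW.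
  have [xyM yxM] := N_contract sx yM yd; rewrite y0 => h1 h2.
  by split; split=> //; apply/le_anti; rewrite N_ge0 andbT; lra.
move=> [mus [uM ud] nu umin] sx /= [k hk].
have [h1 h2] := IH _ mus sx hk.
have ud' : N u <= d by move: d_gt0; lra.
have [xuM uxM n1 n2] := N_contract sx uM ud'.
have Nu : 0 < N u.
  rewrite lt_neqAle N_ge0 andbT eq_sym; apply/eqP => Nu0; apply: nu.
  by apply: span_nil; split.
have inspan z : z \in M -> N z * 2 <= N u -> span us z.
  move=> zM zu; apply: contrapT => nz.
  have := umin z (conj zM _) nz; have z0 := N_ge0 z.
  by move=> /(_ ltac:(lra)); lra.
rewrite -[y](subrK (u *~ k)) rmulDl rmulDr rmulMzl rmulMzr; split; apply: spanD;
  by [exact: span_behead | apply: spanMz; exact: inspan].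
Qed.

(** Linearity in [x] passes from small elements to whole spans. This one fact yields closure of the
    span under products, the ideal property of H, and the loss of one vector per factor. *)
Lemma span_absorb vs us x y : minima vs -> minima us -> span vs x -> span us y ->
  span (behead us) (x ** y) /\ span (behead us) (y ** x).
Proof.
elim: vs x => [|v vs IH] x.
  by move=> _ mus [xM x0]; apply: small_absorb => //; exact: small0.
move=> [mvs sv _ _] mus /= [k hk] hy; have [h1 h2] := IH _ mvs mus hk hy.
have [h3 h4] := small_absorb mus sv hy.
rewrite -[x](subrK (v *~ k)) rmulDl rmulDr rmulMzl rmulMzr.
by split; apply: spanD => //; exact: spanMz.
Qed.

Lemma minima_le us w u : minima us -> small w -> ~ span us w -> u \in us -> N u <= N w.
Proof.
elim: us => // v us IH [mus sv nv vmin] sw nw.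
have nw' : ~ span us w by move=> /(span_cons v).
by rewrite inE => /orP[/eqP ->|]; [exact: vmin | exact: IH].
Qed.

Lemma minima_small us u : minima us -> u \in us -> small u /\ 0 < N u.
Proof.
elim: us => // v us IH [mus [vM vd] nv vmin].
rewrite inE => /orP[/eqP ->|]; last exact: IH.
split; first by split.
rewrite lt_neqAle N_ge0 andbT eq_sym; apply/eqP => Nv0; apply: nv.
by apply: span_nil; split.
Qed.

(* For [a] chosen before [u], the vector [u - 2 ^ (e a - e u) a] is outside the span of the
   vectors chosen before [u], so its norm is at least [N u]; dilate it by [2 ^ e u]. *)
Lemma minima_separated (e : R -> nat) us : minima us ->
  (forall u, small u -> 0 < N u -> N u * 2 ^+ e u <= d / 4 /\ d / 4 < N u * 2 ^+ (e u).+1) ->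
  forall i j, (i < j < size us)%N ->
  d / 16 < N (us`_i *+ 2 ^ e us`_i - us`_j *+ 2 ^ e us`_j).
Proof.
move=> mus eP; elim: us mus => [_ i j|u us IH]; first by rewrite ltn0 andbF.
move=> mu; move=> [|i] [|j] //; last by rewrite /= !ltnS; apply: IH; case: mu.
rewrite /= ltnS => jus; set a := us`_j.
have aus : a \in us by exact: mem_nth.
have [mus su nu umin] := mu.
have [[aM ad] a0] := minima_small mus aus.
have [_ u0] := minima_small mu (mem_head u us).
have au : N a <= N u := minima_le mus su nu aus.
have [[ea1 ea2] [eu1 eu2]] := (eP a (conj aM ad) a0, eP u su u0).
have [uM ud] := su.
have eua : (e u <= e a)%N.
  rewrite leqNgt; apply/negP => lt.
  have : N a * 2 ^+ (e a).+1 <= N u * 2 ^+ e u.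
    apply: ler_pM => //; first by rewrite exprn_ge0.
    by apply: ler_weXn2l => //; lra.
  lra.
have dd : d / 4 <= d by move: d_gt0; lra.
pose z := u - a *+ 2 ^ (e a - e u).
have -> : u *+ 2 ^ e u - a *+ 2 ^ e a = z *+ 2 ^ e u.
  by rewrite mulrnBl -mulrnA -expnD subnK.
have nz : ~ span us z.
  move=> hz; apply: nu; rewrite -[u](subrK (a *+ 2 ^ (e a - e u))).
  by apply: spanD => //; rewrite pmulrn; apply: spanMz; exact: span_mem.
have p0 k : 0 < 2 ^+ k :> RR by exact: exprn_gt0.
have p1 k : 1 <= 2 ^+ k :> RR by apply: exprn_ege1; lra.
have ea3 : N a * 2 ^+ (e a - e u) * 2 ^+ e u <= d / 4.
  by rewrite -mulrA -exprD subnK.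
have ea4 : N a * 2 ^+ (e a - e u) <= d / 4.
  apply: le_trans ea3; rewrite ler_peMr //; exact: mulr_ge0 (N_ge0 a) (ltW (p0 _)).
have [aM' aN'] := exp2_in_ball aM (le_trans ea4 dd).
have zN : N z <= N u + N a * 2 ^+ (e a - e u) by rewrite -aN'; exact: NB.
have zM : z \in M.
  by apply: MB => //; apply: le_trans zN _; move: d_gt0 d_r; lra.
have Nuz : N u <= N z.
  (* Minimality of [u] speaks of small vectors only; a [z] that is not small has norm above d / 4,
     which already bounds [N u]. *)
  have [zs|zs] := lerP (N z) (d / 4); first exact: umin.
  by apply: ltW; apply: le_lt_trans zs.
have zup : N z * 2 ^+ e u <= d / 2.
  have := ler_wpM2r (ltW (p0 (e u))) zN; rewrite mulrDl; lra.
have dd2 : d / 2 <= d by move: d_gt0; lra.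
have [zM' ->] := exp2_in_ball zM (le_trans zup dd2).
have := ler_wpM2r (ltW (p0 (e u))) Nuz.
by move: eu2; rewrite exprSr; move: d_gt0; lra.
Qed.

Lemma minima_size us : minima us -> (size us < C)%N.
Proof.
move=> mus; rewrite ltnNge; apply/negP => Cus.
have /choice[e eP] u : exists q : nat, small u -> 0 < N u ->
    N u * 2 ^+ q <= d / 4 /\ d / 4 < N u * 2 ^+ q.+1.
  have [[su u0]|nu] := pselect (small u /\ 0 < N u); last by exists 0%N => su u0; case: nu.
  by have [q hq] := dyadic_scale u0 su.2; exists q.
have sep := minima_separated mus eP.
pose f (i : 'I_C) := us`_i *+ 2 ^ e us`_i.
have [i|i [j [ij]]] := @packM f.
  have iu : us`_i \in us by apply: mem_nth; exact: leq_trans Cus.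
  have [[uM ud] u0] := minima_small mus iu; have [h _] := eP _ (conj uM ud) u0.
  by apply: (exp2_in_ball uM _).1; apply: le_trans h _; move: d_gt0; lra.
apply/negP; rewrite -ltNge /f.
have [lt|lt|/val_inj eq] := ltngtP i j; last by rewrite eq eqxx in ij.
  by apply: sep; rewrite lt; exact: leq_trans Cus.
by rewrite -NN opprB; apply: sep; rewrite lt; exact: leq_trans Cus.
Qed.

(** A family whose span misses a small element can be lengthened, the next minimum existing because
    M is finite; [minima_size] stops this. *)
Lemma full_minima : exists2 us, minima us & forall x, small x -> span us x.
Proof.
apply: contrapT => no.
have key n : exists2 us, minima us & size us = n.
  elim: n => [|n [us mus <-]]; first by exists [::].
  have [x sx nx] : exists2 x, small x & ~ span us x.
    apply: contrapT => nx; apply: no; exists us => // x sx.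
    by apply: contrapT => nsx; apply: nx; exists x.
  have [u [uM [su nu] umin]] := @seq_argmin _ _ N (fun w => small w /\ ~ span us w) (enum_fset M)
    (ex_intro2 _ _ x sx.1 (conj sx nx)).
  exists (u :: us) => //; split=> // w sw nw; apply: umin => //; exact: sw.1.
by have [us /minima_size + sz] := key C; rewrite sz ltnn.
Qed.

Lemma nilpotent_structure : exists (R' : subrng R) (I : rngIdeal (subrng_type R')),
  [/\ forall x, small x -> x \in (R' : {pred R}),
      forall u : subrng_type R', u \in (I : {pred subrng_type R'}) -> val u \in M
    & nilpotent_class_le (rng_quot I) C].
Proof.
have [us mus full] := full_minima.
have [|R' R'P] := @subrng_of R (span us) (span0 us) (@spanB us).
  by move=> x y hx hy; apply: span_behead; exact: (span_absorb mus mus hx hy).1.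
have [|||I IP] := @rngIdeal_of (subrng_type R') (fun u : subrng_type R' => span [::] (val u)).
- exact: span0 [::].
- by move=> x y hx hy; exact: (@spanB [::] (val x) (val y)).
- move=> a x hx; have /R'P ha := valP a.
  exact: (@span_absorb us [::] (val a) (val x) mus _ ha hx).
exists R', I; split=> [x /full/R'P //|u /IP[] //|].
apply: rng_quot_nilpotent => x s; apply/IP.
have mdrop k : minima (drop k us).
  elim: us mus k {full R'P} => [|u vs IH] // mvs [|k]; first exact: mvs.
  by rewrite /=; apply: IH; case: mvs.
(* Every further factor drops the most recent vector. As [size us < C], none is left after [C]
   factors and the product lies in H. *)
have main (t : seq (subrng_type R')) k (y : subrng_type R') : span (drop k us) (val y) ->
    span (drop (k + size t) us) (val (foldl (@rmul (subrng_type R')) y t)).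
  elim: t k y => [|z t IH] k y hy /=; first by rewrite addn0.
  rewrite addnS -addSn; apply: IH.
  have /R'P hz := valP z.
  have := (span_absorb mus (mdrop k) hz hy).2.
  by rewrite -[behead _]drop1 drop_drop add1n.
have /R'P hx := valP x.
have := main s 0%N x; rewrite drop0 => /(_ hx).
by rewrite add0n size_tuple drop_oversize // ltnW // minima_size.
Qed.

End SuccessiveMinima.

(** * Bogolyubov's argument *)

Section Fourier.
Local Open Scope fset_scope.
Local Open Scope ring_scope.
Variable RR : realType.

Section Zmod.
Variable V : zmodType.
Implicit Types (t : V -> RR) (s : seq V).

Definition csum t s := \sum_(x <- s) cos1 (t x).
Definition ssum t s := \sum_(x <- s) sin1 (t x).

Lemma csum_add t s s' : is_mod1 t ->
  csum t [seq x + y | x <- s, y <- s'] = csum t s * csum t s' - ssum t s * ssum t s'.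
Proof.
move=> tD; rewrite /csum big_allpairs_dep !mulr_suml -sumrB; apply: eq_bigr => x _.
by rewrite !mulr_sumr -sumrB; apply: eq_bigr => y _; rewrite cos1_mod1D.
Qed.

Lemma ssum_add t s s' : is_mod1 t ->
  ssum t [seq x + y | x <- s, y <- s'] = ssum t s * csum t s' + csum t s * ssum t s'.
Proof.
move=> tD; rewrite /ssum big_allpairs_dep !mulr_suml -big_split; apply: eq_bigr => x _ /=.
by rewrite !mulr_sumr -big_split; apply: eq_bigr => y _ /=; rewrite sin1_mod1D.
Qed.

Lemma sum_symmetric (X : {fset V}) (F : V -> RR) : (forall x, x \in X -> - x \in X) ->
  \sum_(x <- X) F (- x) = \sum_(x <- X) F x.
Proof.
move=> XN; have e : [fset - x | x in X] = X.
  apply/fsetP => y; apply/imfsetP/idP => [[x /= /XN xX -> //]|yX].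
  by exists (- y); rewrite ?opprK //=; exact: XN.
by rewrite -[in RHS]e big_imfset //= => x y _ _; exact: oppr_inj.
Qed.

Lemma ssum_symmetric t (X : {fset V}) : is_mod1 t -> (forall x, x \in X -> - x \in X) ->
  ssum t X = 0.
Proof.
move=> tD XN; have : ssum t X = - ssum t X.
  rewrite /ssum -{1}(sum_symmetric _ XN) -sumrN; apply: eq_bigr => x _.
  by rewrite sin1_mod1N.
lra.
Qed.

Section Orthogonality.
Variables (I : finType) (g : I -> V -> RR).
Hypothesis gD : forall i, is_mod1 (g i).

(** Fourier inversion over the finite family. The vanishing of [ssum] makes the transform of [s]
    real, so [csum ^+ 2] is its squared modulus, and orthogonality keeps only the pairs with w - w'
    = x. *)
Lemma spectral_sum s x : (forall i, ssum (g i) s = 0) ->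
  (forall w w', w \in s -> w' \in s -> w - w' - x != 0 ->
    \sum_i cos1 (g i (w - w' - x)) = 0) ->
  \sum_i csum (g i) s ^+ 2 * cos1 (g i x) =
    #|I|%:R * \sum_(w <- s) \sum_(w' <- s) (w - w' == x)%:R.
Proof.
move=> s0 orth.
have e i : csum (g i) s ^+ 2 * cos1 (g i x) =
    \sum_(w <- s) \sum_(w' <- s) cos1 (g i (w - w' - x)).
  have e1 w : \sum_(w' <- s) cos1 (g i (w - w' - x)) =
      csum (g i) s * (cos1 (g i w) * cos1 (g i x) + sin1 (g i w) * sin1 (g i x)).
    transitivity (csum (g i) s * (cos1 (g i w) * cos1 (g i x) + sin1 (g i w) * sin1 (g i x)) +
        ssum (g i) s * (sin1 (g i w) * cos1 (g i x) - cos1 (g i w) * sin1 (g i x))).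
      rewrite /csum /ssum !mulr_suml -big_split; apply: eq_bigr => w' _ /=.
      rewrite !(cos1_mod1D (gD i), sin1_mod1D (gD i), cos1_mod1N (gD i), sin1_mod1N (gD i)).
      by ring.
    by rewrite s0 mul0r addr0.
  under eq_bigr => w _ do rewrite e1.
  rewrite -mulr_sumr big_split /= -!mulr_suml -/(csum _ _) -/(ssum _ _) s0; ring.
under eq_bigr => i _ do rewrite e.
rewrite exchange_big /= mulr_sumr; apply: eq_big_seq => w ws.
rewrite exchange_big /= mulr_sumr; apply: eq_big_seq => w' ws'.
have [<-|ne] := eqVneq (w - w') x; last by rewrite orth ?mulr0 // subr_eq0.
under eq_bigr => i _ do rewrite subrr (cos1_mod1_0 (gD i)).
by rewrite sumr_const mulr1.
Qed.

(** Cauchy-Schwarz for the multiplicities in [s] of the points of [U]. *)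
Lemma energy_lower s (U : {fset V}) : (forall w, w \in s -> w \in U) ->
  (size s)%:R ^+ 2 <= #|` U|%:R * \sum_(w <- s) \sum_(w' <- s) (w - w' == 0)%:R :> RR.
Proof.
move=> sU.
have sum1 w : w \in s -> \sum_(z <- U) (w == z)%:R = 1 :> RR.
  move=> ws; rewrite (big_fsetD1 w (sU _ ws)) /= eqxx big_seq big1 ?addr0 // => z.
  by rewrite in_fsetD1 eq_sym => /andP[/negbTE ->].
have := cauchy_schwarz_sum (enum_fset U) (fun z => \sum_(w <- s) (w == z)%:R : RR).
rewrite exchange_big /=; congr (_ ^+ 2 <= _ * _).
  by rewrite -sum1_size natr_sum; apply: eq_big_seq => w /sum1.
under eq_bigr => z _ do rewrite expr2 mulr_suml; rewrite exchange_big /=.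
apply: eq_big_seq => w ws.
under eq_bigr => z _ do rewrite mulr_sumr; rewrite exchange_big /=.
apply: eq_bigr => w' _; rewrite subr_eq0.
have [<-|ne] := eqVneq w w'.
  rewrite -[RHS](sum1 w ws); apply: eq_bigr => z _.
  by case: eqP; rewrite ?mulr1 ?mulr0.
rewrite mulr0n; apply: big1 => z _; have [wz|_] := eqVneq w z; last by rewrite mul0r.
by rewrite -wz eq_sym (negbTE ne) mulr0.
Qed.

End Orthogonality.
End Zmod.

Section Positivity.
Variables (R : rngType) (X : {fset R}).
Hypothesis XN : forall x, x \in X -> - x \in X.
Hypothesis X0 : 0 \in X.

(** Lists keep multiplicities: [sums_products] stands for the convolution of two copies of X with
    the law of [x ** y], so its transform factors. *)
Definition products : seq R := [seq x ** y | x <- X, y <- X].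
Definition sums : seq R := [seq x + y | x <- X, y <- X].
Definition sums_products : seq R := [seq s + p | s <- sums, p <- products].

Lemma sums_productsP w : reflect (exists x y a b,
  [/\ x \in X, y \in X, a \in X, b \in X & w = x + y + a ** b]) (w \in sums_products).
Proof.
apply: (iffP allpairsP) => [[[s p] /= []]|[x [y [a [b [xX yX aX bX ->]]]]]].
  move=> /allpairsP[[x y] /= [xX yX ->]] /allpairsP[[a b] /= [aX bX ->]] ->.
  by exists x, y, a, b.
exists (x + y, a ** b); split=> //=; apply/allpairsP; [by exists (x, y) | by exists (a, b)].
Qed.

Lemma size_sums_products : size sums_products = (#|` X| ^ 4)%N.
Proof. by rewrite !size_allpairs !expnS expn0 muln1 !mulnA. Qed.

Lemma ssum_products (t : R -> RR) : is_mod1 t -> ssum t products = 0.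
Proof.
move=> tD; rewrite /ssum big_allpairs_dep.
have : \sum_(x <- X) \sum_(y <- X) sin1 (t (x ** y)) = - \sum_(x <- X) \sum_(y <- X) sin1 (t (x ** y)).
  rewrite -{1}(sum_symmetric (fun x => \sum_(y <- X) sin1 (t (x ** y))) XN) -sumrN.
  apply: eq_bigr => x _; rewrite -sumrN; apply: eq_bigr => y _.
  by rewrite rmulNl sin1_mod1N.
lra.
Qed.

Lemma csum_sums_products (t : R -> RR) : is_mod1 t ->
  csum t sums_products = csum t X ^+ 2 * csum t products /\ ssum t sums_products = 0.
Proof.
move=> tD; have sX : ssum t X = 0 by exact: ssum_symmetric.
have [hc hs] : csum t sums = csum t X ^+ 2 /\ ssum t sums = 0.
  by rewrite /sums csum_add // ssum_add // sX; split; ring.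
by rewrite /sums_products csum_add // hc hs ssum_add // hc hs ssum_products //; split; ring.
Qed.

Lemma norm_csum_le (t : R -> RR) s : `|csum t s| <= (size s)%:R.
Proof.
apply: le_trans (ler_norm_sum _ _ _) _; rewrite -sum1_size natr_sum.
by apply: ler_sum => x _; exact: norm_cos1.
Qed.

(* Bogolyubov's positivity argument for [1_X * 1_X * (law of ab)]. *)
Lemma bohr_sums_products (I : finType) (g : I -> R -> RR) (U : {fset R}) (L e : RR) x :
  (0 < #|I|)%N -> (forall i, is_mod1 (g i)) -> 0 <= e -> 3 * e ^+ 2 * L < 1 ->
  (forall w, w \in sums_products -> w \in U) -> #|` U|%:R <= L * #|` X|%:R ->
  (forall w w' y, w \in sums_products -> w' \in sums_products -> y = x \/ y = 0 ->
     w - w' - y != 0 -> \sum_i cos1 (g i (w - w' - y)) = 0) ->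
  (forall i, e * #|` X|%:R <= `|csum (g i) X| ->
     e * #|` X|%:R ^+ 2 <= `|csum (g i) products| -> nrm (g i x) <= 8^-1) ->
  exists w w', [/\ w \in sums_products, w' \in sums_products & x = w - w'].
Proof.
move=> I0 gD e0 eL sU UL orth spec; apply: contrapT => no.
set n : RR := #|` X|%:R in UL spec.
have n0 : 0 < n by rewrite ltr0n cardfs_gt0; apply/fset0Pn; exists 0.
have n0' : 0 <= n by exact: ltW.
pose h i := csum (g i) sums_products; pose c i := csum (g i) X; pose p i := csum (g i) products.
have hE i : h i = c i ^+ 2 * p i by exact: (csum_sums_products (gD i)).1.
have s0 i : ssum (g i) sums_products = 0 by exact: (csum_sums_products (gD i)).2.
(* Up to the factor |I| this counts the pairs with w - w' = x, and there are none. *)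
have h0 : \sum_i h i ^+ 2 * cos1 (g i x) = 0.
  rewrite (spectral_sum gD s0) => [|w w' ws ws' ne]; last by apply: orth => //; left.
  rewrite big_seq big1 ?mulr0 // => w ws; rewrite big_seq big1 // => w' ws'.
  by case: eqP => // xE; case: no; exists w, w'.
(* The same count at 0: the n^4 terms of [sums_products] lie in at most L n points, so at least n^7
   / L pairs coincide. *)
have T : #|I|%:R * n ^+ 7 <= L * \sum_i h i ^+ 2.
  have : \sum_i h i ^+ 2 = \sum_i h i ^+ 2 * cos1 (g i 0).
    by apply: eq_bigr => i _; rewrite cos1_mod1_0 ?mulr1.
  rewrite (spectral_sum gD s0) => [->|w w' ws ws' ne]; last by apply: orth => //; right.
  have := @energy_lower _ sums_products U sU; rewrite size_sums_products natrX -/n.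
  set E := \sum_(_ <- _) _ => hU.
  have E0 : 0 <= E by apply: sumr_ge0 => w _; apply: sumr_ge0.
  have : n ^+ 8 <= L * n * E.
    by apply: le_trans (le_trans hU (ler_wpM2r E0 UL)); rewrite -exprM.
  have -> : n ^+ 8 = n * n ^+ 7 by rewrite -exprS.
  rewrite [L * n]mulrC -mulrA ler_pM2l // => h7.
  by rewrite [leRHS]mulrCA; apply: ler_wpM2l.
have c2 : \sum_i c i ^+ 2 = #|I|%:R * n.
  have -> : \sum_i c i ^+ 2 = \sum_i c i ^+ 2 * cos1 (g i 0).
    by apply: eq_bigr => i _; rewrite cos1_mod1_0 ?mulr1.
  rewrite (spectral_sum gD) => [|i|w w' wX wX' ne]; last 2 first.
  - exact: ssum_symmetric.
  - have := orth (w + 0 + 0 ** 0) (w' + 0 + 0 ** 0) 0.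
    rewrite rmul0r !addr0; apply=> //; last by right.
      by apply/sums_productsP; exists w, 0, 0, 0; rewrite rmul0r !addr0.
    by apply/sums_productsP; exists w', 0, 0, 0; rewrite rmul0r !addr0.
  congr (_ * _); rewrite /n card_fset_sum1 natr_sum; apply: eq_big_seq => w wX.
  rewrite (big_fsetD1 w wX) /= subrr eqxx big_seq big1 ?addr0 // => z.
  by rewrite in_fsetD1 subr_eq0 eq_sym => /andP[/negbTE ->].
have sizeP : (size products)%:R = n ^+ 2 :> RR by rewrite size_allpairs natrM expr2.
(* On the spectrum the cosine is at least 1/2. Off it, twice the cosine term is at least -2 h^2 =
   h^2 - 3 h^2, which explains the 3, and one of the two small sums saves the factor e^2 in h^2. One
   factor c^2 is left untouched for Parseval ([c2]). *)
have pt i : h i ^+ 2 - 3 * (e ^+ 2 * n ^+ 6 * c i ^+ 2) <= h i ^+ 2 * cos1 (g i x) *+ 2.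
  have hh : 0 <= h i ^+ 2 := sqr_ge0 _.
  have cc : 0 <= c i ^+ 2 := sqr_ge0 _.
  have big0 : 0 <= e ^+ 2 * n ^+ 6 * c i ^+ 2.
    by rewrite mulr_ge0 // mulr_ge0 ?exprn_ge0 // ltW.
  have [[b1 b2]|nb] := pselect (e * n <= `|c i| /\ e * n ^+ 2 <= `|p i|).
    have := cos1_near (spec i b1 b2) => hcos.
    have := ler_wpM2l hh hcos; rewrite -mulr_natr; lra.
  suff : h i ^+ 2 <= e ^+ 2 * n ^+ 6 * c i ^+ 2.
    have := ler_wpM2l hh (cos1_geN1 (g i x)); rewrite -mulr_natr; lra.
  have cn : c i ^+ 2 <= n ^+ 2.
    by rewrite -real_normK ?num_real //; apply: lerXn2r; rewrite ?nnegrE //; exact: norm_csum_le.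
  have pn : p i ^+ 2 <= (n ^+ 2) ^+ 2.
    rewrite -real_normK ?num_real // -sizeP; apply: lerXn2r; rewrite ?nnegrE //; exact: norm_csum_le.
  have -> : h i ^+ 2 = c i ^+ 2 * (c i ^+ 2 * p i ^+ 2) by rewrite hE; ring.
  rewrite [leRHS]mulrC; apply: ler_wpM2l => //.
  have [b1|b1] := lerP (e * n) `|c i|.
    have b2 : `|p i| < e * n ^+ 2 by rewrite ltNge; apply/negP => b2; apply: nb.
    have -> : e ^+ 2 * n ^+ 6 = n ^+ 2 * (e * n ^+ 2) ^+ 2 by ring.
    apply: ler_pM => //; first exact: sqr_ge0.
    rewrite -[p i ^+ 2]real_normK ?num_real //; apply: lerXn2r; rewrite ?nnegrE ?(ltW b2) //.
    by rewrite mulr_ge0 // sqr_ge0.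
  have -> : e ^+ 2 * n ^+ 6 = (e * n) ^+ 2 * (n ^+ 2) ^+ 2 by ring.
  apply: ler_pM => //; first exact: sqr_ge0.
  rewrite -[c i ^+ 2]real_normK ?num_real //; apply: lerXn2r; rewrite ?nnegrE ?(ltW b1) //.
  by rewrite mulr_ge0 // ltW.
have : \sum_i (h i ^+ 2 - 3 * (e ^+ 2 * n ^+ 6 * c i ^+ 2)) <= \sum_i h i ^+ 2 * cos1 (g i x) *+ 2.
  by apply: ler_sum => i _; exact: pt.
rewrite sumrMnl h0 mul0rn sumrB -2!mulr_sumr c2 => tot.
have L0 : 0 < L.
  rewrite ltNge; apply/negP => L0.
  have : 0 < #|I|%:R * n ^+ 7 by rewrite mulr_gt0 ?exprn_gt0 // ltr0n.
  have : L * \sum_i h i ^+ 2 <= 0 by rewrite mulr_le0_ge0 // sumr_ge0 // => i _; exact: sqr_ge0.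
  lra.
have : L * \sum_i h i ^+ 2 <= L * (3 * (e ^+ 2 * n ^+ 6 * (#|I|%:R * n))).
  by rewrite ler_pM2l //; lra.
have -> : L * (3 * (e ^+ 2 * n ^+ 6 * (#|I|%:R * n))) = (3 * e ^+ 2 * L) * (#|I|%:R * n ^+ 7) by ring.
move=> /(le_trans T); apply/negP; rewrite -ltNge -[ltRHS]mul1r ltr_pM2r //.
by rewrite mulr_gt0 ?exprn_gt0 // ltr0n.
Qed.

End Positivity.
End Fourier.

(** * Total boundedness of the translates of a character *)

Section Covers.
Local Open Scope fset_scope.
Local Open Scope ring_scope.
Variable V : zmodType.
Implicit Types (X : {fset V}) (S : V -> Prop) (k l : nat).

Definition covers k X S := exists2 tr : seq V, (size tr <= k)%N &
  forall x, S x -> exists2 t, t \in tr & x - t \in X.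

Lemma covers_sub k X S S' : (forall x, S x -> S' x) -> covers k X S' -> covers k X S.
Proof. by move=> h [tr tk cov]; exists tr => // x /h/cov. Qed.

Lemma covers_self X : covers 1 X (fun x => x \in X).
Proof. by exists [:: 0] => // x xX; exists 0; rewrite ?mem_head // subr0. Qed.

Lemma covers_shift k X S a : covers k X S -> covers k X (fun x => S (x - a)).
Proof.
move=> [tr tk cov]; exists [seq a + t | t <- tr]; first by rewrite size_map.
by move=> x /cov[t ttr xt]; exists (a + t); [exact: map_f | rewrite opprD addrA].
Qed.

Lemma covers_or k l X S S' : covers k X S -> covers l X S' ->
  covers (k + l) X (fun x => S x \/ S' x).
Proof.
move=> [tr tk cov] [tr' tl cov']; exists (tr ++ tr'); first by rewrite size_cat leq_add.
by move=> x [/cov|/cov'] [t tin xt]; exists t => //; rewrite mem_cat tin ?orbT.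
Qed.

Lemma covers_union k X (s : seq V) (S : V -> V -> Prop) : (forall t, t \in s -> covers k X (S t)) ->
  covers (size s * k) X (fun x => exists2 t, t \in s & S t x).
Proof.
elim: s => [|a s IH] h; first by exists [::] => // x [].
have h1 := h a (mem_head _ _).
have h2 : covers (size s * k) X (fun x => exists2 t, t \in s & S t x).
  by apply: IH => t ts; apply: h; rewrite inE ts orbT.
apply: covers_sub (covers_or h1 h2) => x [t].
by rewrite inE => /orP[/eqP ->|ts] St; [left | right; exists t].
Qed.

Lemma covers_le k l X S : (k <= l)%N -> covers k X S -> covers l X S.
Proof. by move=> kl [tr tk cov]; exists tr => //; exact: leq_trans kl. Qed.

Definition sumP S S' z := exists x y, [/\ S x, S' y & z = x + y].

Lemma covers_sum K k l X S S' : covers K X (sumP (fun x => x \in X) (fun x => x \in X)) ->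
  covers k X S -> covers l X S' -> covers (k * (l * K)) X (sumP S S').
Proof.
move=> covXX [tr tk cov] [tr' tl cov'].
have h : covers (size tr * (size tr' * K)) X (fun x => exists2 t, t \in tr &
    exists2 t', t' \in tr' & sumP (fun x => x \in X) (fun x => x \in X) (x - t - t')).
  apply: covers_union => t _; apply: covers_union => t' _.
  apply: (covers_shift t (S := fun x => sumP _ _ (x - t'))); exact: covers_shift.
apply: covers_le (leq_mul tk (leq_mul tl (leqnn K))) (covers_sub _ h).
move=> z [x [y [/cov[t ttr xt] /cov'[t' ttr' yt] ->]]].
exists t => //; exists t' => //; exists (x - t), (y - t'); split=> //.
by rewrite -[LHS]addrA addrACA.
Qed.

Lemma covers_card k X (A : {fset V}) : covers k X (fun x => x \in A) -> (#|` A| <= k * #|` X|)%N.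
Proof.
move=> [tr tk cov]; apply: (@leq_trans (size [seq t + x | t <- tr, x <- X])).
  apply: uniq_leq_size => // x /cov[t ttr xt]; apply/allpairsP; exists (t, x - t).
  by split=> //=; rewrite addrC subrK.
by rewrite size_allpairs leq_mul2r tk orbT.
Qed.

End Covers.

Lemma colored_pigeon (T : Type) n (P : T -> Prop) rel (f : 'I_n.+1 -> T) :
  colored n P rel -> (forall i, P (f i)) -> exists i j, i != j /\ rel (f i) (f j).
Proof.
move=> [c c1 c2] fP; apply: contrapT => no.
pose h i : 'I_n := Ordinal (c1 _ (fP i)).
have hI : injective h.
  move=> i j /(congr1 val) /= e; apply/eqP; apply: contraT => ij.
  by case: no; exists i, j; split=> //; exact: c2.
by have := leq_card h hI; rewrite !card_ord ltnn.
Qed.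

(** Color [x] by its translate [t] together with the color of [x - t]; two points in one translate
    have the same difference before and after the shift. *)
Lemma colored_covered (V : zmodType) (X : {fset V}) (D : V -> Prop) k n rel rel' :
  covers k X D -> colored n (fun x => x \in X) rel ->
  (forall x y t, x - t \in X -> y - t \in X -> rel (x - t) (y - t) -> rel' x y) ->
  colored (k * n) D rel'.
Proof.
move=> [tr tk cov] col h.
have /choice[s sP] x : exists t, D x -> t \in tr /\ x - t \in X.
  have [/cov[t ttr xt]|nD] := pselect (D x); first by exists t.
  by exists 0.
have col1 : colored (size tr) D (fun x y => s x = s y).
  exists (fun x => index (s x) tr) => [x /sP[xt _]|x y /sP[xt _] /sP[yt _] e].
    by rewrite index_mem.
  by rewrite -(nth_index 0 xt) e nth_index.
have col2 : colored n D (fun x y => rel (x - s x) (y - s y)).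
  by apply: colored_sub (colored_preim (fun x => x - s x) col) => // x /sP[].
apply: colored_le (leq_mul tk (leqnn n)) _.
apply: colored_sub (colored_and col1 col2) => // x y Dx Dy [e r].
apply: (h _ _ (s x)); [exact: (sP _ Dx).2 | rewrite e; exact: (sP _ Dy).2 |].
by rewrite {2}e.
Qed.

Section LeftTranslates.
Local Open Scope fset_scope.
Local Open Scope ring_scope.
Variable RR : realType.

Lemma fset_pigeonhole (V : choiceType) (A : {fset V}) (c : V -> nat) n :
  (forall x, x \in A -> (c x < n)%N) -> A != fset0 ->
  exists k, (#|` A| <= n * #|` [fset x in A | c x == k]|)%N.
Proof.
move=> cn A0; apply: contrapT => no.
have small k : (n * #|` [fset x in A | c x == k]| < #|` A|)%N.
  by rewrite ltnNge; apply/negP => h; apply: no; exists k.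
have n0 : (0 < n)%N by have /fset0Pn[x /cn] := A0; case: n {cn small no}.
have : (n * #|` A| < n * #|` A|)%N; last by rewrite ltnn.
have {1}-> : #|` A| = (\sum_(k < n) #|` [fset x in A | c x == k]|)%N.
  under [RHS]eq_bigr => k _ do rewrite card_fset_sum1 big_fset /= big_mkcond.
  rewrite exchange_big /= card_fset_sum1; apply: eq_big_seq => x xA.
  by rewrite -big_mkcond /= (big_pred1 (Ordinal (cn x xA))).
rewrite big_distrr /=; apply: (@leq_trans (\sum_(k < n) #|` A|)%N); last first.
  by rewrite sum_nat_const card_ord.
case: n n0 {cn no} small => // n _ small.
rewrite !big_ord_recl -addSn; apply: leq_add; first exact: small.
by apply: leq_sum => k _; exact: ltnW.
Qed.

Lemma is_mod1_mull (R : rngType) (t : R -> RR) a : is_mod1 t -> is_mod1 (fun x => t (a ** x)).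
Proof. by move=> tD x y; rewrite rmulDr. Qed.

Lemma is_mod1_mulr (R : rngType) (t : R -> RR) a : is_mod1 t -> is_mod1 (fun x => t (x ** a)).
Proof. by move=> tD x y; rewrite rmulDl. Qed.

(** The large sum over products adds up the sums of t(a _), so a positive proportion of the [a] put
    t(a _) into the large spectrum. Total boundedness and pigeonhole leave a dense subset [A1] of X
    on which these characters nearly agree. By [translates_overlap], among any [n] elements of X two
    differ by a difference of elements of [A1]. *)
Lemma left_translates_colored (K e d : RR) : 1 <= K -> 0 < e -> 0 < d ->
  exists n, forall (R : rngType) (X : {fset R}) (t : R -> RR), 0 \in X ->
    #|` sumset X X|%:R <= K * #|` X|%:R -> is_mod1 t ->
    e * #|` X|%:R ^+ 2 <= `|csum t (products X)| ->
    colored n (fun a => a \in X) (fun a b => forall x, x \in X -> nrm (t ((a - b) ** x)) <= d).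
Proof.
move=> K1 e0 d0.
have e20 : 0 < e / 2 by lra.
have d20 : 0 < d / 2 by lra.
have [n0 spec] := spectrum_colored K1 e20 d20.
pose a := e / 2 / n0.+1%:R.
have a0 : 0 < a by rewrite divr_gt0.
pose n := (Num.truncn (2 * K / a ^+ 2)).+1.
exists n => R X t X0 XX tD big.
set x : RR := #|` X|%:R in XX big *.
have x0 : 0 < x by rewrite ltr0n cardfs_gt0; apply/fset0Pn; exists 0.
pose la b : R -> RR := fun y => t (b ** y).
pose A0 := [fset b in X | e / 2 * x <= `|csum (la b) X|].
have A0X : A0 `<=` X by exact: fset_sub.
have A0big : e / 2 * x <= #|` A0|%:R.
  (* Popularity: elements outside [A0] contribute at most e |X| / 2 each, the others at most |X|. *)
  have h : `|csum t (products X)| <= \sum_(b <- X) (x * (b \in A0)%:R + e / 2 * x).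
    rewrite /csum big_allpairs_dep; apply: le_trans (ler_norm_sum _ _ _) _.
    rewrite big_seq [leRHS]big_seq; apply: ler_sum => b bX.
    rewrite !inE bX /= -/(csum (la b) X); have [_|lt] := lerP (e / 2 * x) `|csum (la b) X|.
      rewrite mulr1; apply: le_trans (norm_csum_le _ _) _.
      by rewrite lerDl mulr_ge0 // ltW.
    by rewrite mulr0 add0r ltW.
  move: h; rewrite big_split /= -mulr_sumr sum_indicator // => h.
  have e2 : \sum_(b <- X) e / 2 * x = x * (e / 2 * x).
    by rewrite /x card_fset_sum1 natr_sum mulr_suml; apply: eq_bigr => b _; rewrite mul1r.
  have := le_trans big h; rewrite e2 => h2.
  rewrite -(ler_pM2l x0); move: h2; rewrite expr2; lra.
have A0n : A0 != fset0.
  by rewrite -cardfs_gt0 -(ltr0n RR); apply: lt_le_trans A0big; exact: mulr_gt0.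
have [c c1 c2] := spec R X X0 XX.
have [|k A1big] := @fset_pigeonhole _ A0 (fun b => c (la b)) n0.+1 _ A0n.
  by move=> b; rewrite !inE => /andP[bX hb]; apply/ltnW/c1; split=> //; exact: is_mod1_mull.
set A1 := [fset b in A0 | _] in A1big.
have A1A0 : A1 `<=` A0 by exact: fset_sub.
have A1a : a * x <= #|` A1|%:R.
  have : #|` A0|%:R <= n0.+1%:R * #|` A1|%:R :> RR by rewrite -natrM ler_nat.
  rewrite /a mulrAC ler_pdivrMr ?ltr0n // [leRHS]mulrC; exact: le_trans.
have na : 2 * K < n%:R * a ^+ 2 by rewrite -ltr_pdivrMr ?exprn_gt0 // truncnS_gt.
have close u v y : u \in A1 -> v \in A1 -> y \in X -> nrm (t (u ** y - v ** y)) <= d / 2.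
  rewrite !inE => /andP[/andP[uX hu] /eqP cu] /andP[/andP[vX hv] /eqP cv] yX.
  rewrite (nrm_mod1B tD); apply: (c2 (la u) (la v)) => //; last by rewrite cu cv.
    by split=> //; exact: is_mod1_mull.
  by split=> //; exact: is_mod1_mull.
pose rl u v := forall y, y \in X -> nrm (t ((u - v) ** y)) <= d / 2.
have [||m [r [mn rX rcov]]] := @packing_net _ n (fun b => b \in X) rl.
- by move=> u v h y /h; rewrite -(nrm_mod1N tD) -rmulNl opprB.
- move=> f fX.
  have [i [j [ij]]] := translates_overlap K1 a0 na x0 XX (fsubset_trans A1A0 A0X) A1a fX.
  set B := A1 `&` _ => Bbig; exists i, j; split=> // y yX.
  (* A point [u] of the overlap writes [f i - f j] as the difference of two elements of [A1]. *)
  have /fset0Pn[u] : B != fset0.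
    rewrite -cardfs_gt0 -(ltr0n RR); apply: lt_le_trans Bbig.
    by rewrite mulr_gt0 // divr_gt0 ?exprn_gt0 //; lra.
  rewrite in_fsetI in_shift => /andP[u1 u2].
  have -> : (f i - f j) ** y = u ** y - (u - (f i - f j)) ** y by rewrite -rmulBl subKr.
  exact: close.
apply: colored_le (ltnW mn) _; apply: (net_colored (rel := rl)) rcov _ => u v i _ _ hu hv y yX.
have -> : (u - v) ** y = (u - r i) ** y - (v - r i) ** y.
  by rewrite -rmulBl opprB addrA subrK.
apply: le_trans (nrm_mod1B_le tD _ _) _.
by have := hu y yX; have := hv y yX; lra.
Qed.

End LeftTranslates.

(** * Covers of iterated sums and products by translates of X *)

Section ProductCovers.
Local Open Scope fset_scope.
Local Open Scope ring_scope.
Variable R : rngType.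
Implicit Types (X : {fset R}) (S : R -> Prop).

Definition prodP S S' z := exists x y, [/\ S x, S' y & z = x ** y].

Definition approx_fset (K : nat) X := [/\ 0 \in X, forall x, x \in X -> - x \in X,
  covers K X (sumP (fun x => x \in X) (fun x => x \in X)) &
  covers K X (prodP (fun x => x \in X) (fun x => x \in X))].

Definition bohr_ambient X : {fset R} :=
  [fset x in [seq w - w' | w <- sums_products X, w' <- sums_products X]].

Variables (K : nat) (X : {fset R}).
Hypothesis apX : approx_fset K X.
Let X0 : 0 \in X. Proof. by case: apX. Qed.
Let XN x : x \in X -> - x \in X. Proof. by case: apX => _ + _ _; apply. Qed.
Let XX : covers K X (sumP (fun x => x \in X) (fun x => x \in X)). Proof. by case: apX. Qed.
Let PP : covers K X (prodP (fun x => x \in X) (fun x => x \in X)). Proof. by case: apX. Qed.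

Local Notation inX := (fun x => x \in X).
Local Notation PX := (prodP inX inX).
Local Notation M := (bohr_ambient X).

Lemma bohr_ambientP z : reflect (exists w w',
  [/\ w \in sums_products X, w' \in sums_products X & z = w - w']) (z \in M).
Proof.
rewrite inE; apply: (iffP allpairsP) => [[[w w'] /= []]|[w [w' [ws ws' ->]]]].
  by exists w, w'.
by exists (w, w').
Qed.

Lemma sums_productsN w : w \in sums_products X -> - w \in sums_products X.
Proof.
move=> /sums_productsP[x [y [a [b [xX yX aX bX ->]]]]]; apply/sums_productsP.
by exists (- x), (- y), (- a), b; rewrite !XN // rmulNl !opprD.
Qed.

Lemma sums_products_sub x y a b : x \in X -> y \in X -> a \in X -> b \in X ->
  x + y + a ** b \in sums_products X.
Proof. by move=> xX yX aX bX; apply/sums_productsP; exists x, y, a, b. Qed.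

Lemma bohr_ambientN z : z \in M -> - z \in M.
Proof.
move=> /bohr_ambientP[w [w' [ws ws' ->]]]; apply/bohr_ambientP; exists w', w.
by rewrite opprB.
Qed.

Lemma bohr_ambient0 : 0 \in M.
Proof.
apply/bohr_ambientP; exists (0 + 0 + 0 ** 0), (0 + 0 + 0 ** 0).
by rewrite subrr !sums_products_sub.
Qed.

Lemma bohr_ambientB x y : x \in X -> y \in X -> x - y \in M.
Proof.
move=> xX yX; apply/bohr_ambientP; exists (x + 0 + 0 ** 0), (y + 0 + 0 ** 0).
by rewrite !sums_products_sub // rmul0r !addr0.
Qed.

Let sum2 k l S S' := @covers_sum R K k l X S S' XX.

Lemma covers_sums_products : covers (K * (K * K)) X (fun w => w \in sums_products X).
Proof.
apply: covers_sub (sum2 XX PP) => w /sums_productsP[x [y [a [b [xX yX aX bX ->]]]]].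
by exists (x + y), (a ** b); split=> //; [exists x, y | exists a, b].
Qed.

Lemma covers_bohr_ambient : covers (K * (K * K) * (K * (K * K) * K)) X (fun m => m \in M).
Proof.
apply: covers_sub (sum2 covers_sums_products covers_sums_products) => m.
move=> /bohr_ambientP[w [w' [ws ws' ->]]]; exists w, (- w'); split=> //.
exact: sums_productsN.
Qed.

Definition triple_bound := (K * (K * (K * K) * ((K * K) * K)))%N.

(* If [xy] and [ab] lie in the same translate of [X], then
   [xyz = a(bz) + (xy - ab)z], and [bz] ranges over few translates of [X]. *)
Lemma covers_triple : covers triple_bound X (fun z => exists x y w,
  [/\ x \in X, y \in X, w \in X & z = x ** y ** w]).
Proof.
have [F FK FP] := PP.
pose S t z := exists x y w, [/\ x \in X, y \in X, w \in X, x ** y - t \in X & z = x ** y ** w].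
have covS t : t \in F -> covers (K * (K * K) * ((K * K) * K)) X (S t).
  move=> _; have [[a [b [aX bX abt]]]|no] :=
      pselect (exists a b, [/\ a \in X, b \in X & a ** b - t \in X]); last first.
    by exists [::] => // z [x [y [w [xX yX _ xyt _]]]]; case: no; exists x, y.
  have covab : covers (K * K) X (fun z => exists2 w, w \in X & z = a ** (b ** w)).
    apply: covers_le (leq_mul FK (leqnn K)) _.
    apply: covers_sub (@covers_union R K X F (fun f z => PX (z - a ** f)) _).
      move=> z [w wX ->]; have [f fF bwf] : exists2 f, f \in F & b ** w - f \in X.
        by apply: FP; exists b, w.
      exists f => //; exists a, (b ** w - f); split=> //.
      by rewrite rmulBr.
    by move=> f _; exact: covers_shift.
  apply: covers_sub (sum2 (sum2 PP PP) covab) => z [x [y [w [xX yX wX xyt ->]]]].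
  exists ((x ** y - t) ** w + (- (a ** b - t)) ** w), (a ** (b ** w)); split.
  - exists ((x ** y - t) ** w), ((- (a ** b - t)) ** w); split=> //.
      by exists (x ** y - t), w.
    by exists (- (a ** b - t)), w; split=> //; exact: XN.
  - by exists w.
  - by rewrite -rmulDl opprB addrA subrK rmulA -rmulDl subrK.
apply: covers_le (leq_mul FK (leqnn _)) _.
apply: covers_sub (covers_union covS) => z [x [y [w [xX yX wX ->]]]].
have [t tF xyt] : exists2 t, t \in F & x ** y - t \in X by apply: FP; exists x, y.
by exists t => //; exists x, y, w.
Qed.

Definition module_bound := (K * (K * K) * (triple_bound * K))%N.

(** a(x + y + cd) = ax + ay + acd, and acd is a triple product. The twisted characters are evaluated
    on products of X and M, whereas closeness in the spectrum is first known on X only. *)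
Lemma covers_left : covers (module_bound * (module_bound * K)) X
  (fun z => exists a m, [/\ a \in X, m \in M & z = a ** m]).
Proof.
have c1 := sum2 (sum2 PP PP) covers_triple.
have key a w : a \in X -> w \in sums_products X ->
    sumP (sumP PX PX) (fun z => exists x y w, [/\ x \in X, y \in X, w \in X & z = x ** y ** w]) (a ** w).
  move=> aX /sums_productsP[x [y [c [d [xX yX cX dX ->]]]]].
  exists (a ** x + a ** y), (a ** c ** d); split.
  - by exists (a ** x), (a ** y); split=> //; [exists a, x | exists a, y].
  - by exists a, c, d.
  - by rewrite !rmulDr rmulA.
apply: covers_sub (sum2 c1 c1) => z [a [m [aX /bohr_ambientP[w [w' [ws ws' ->]]] ->]]].
exists (a ** w), (a ** (- w')); split; [exact: key | | by rewrite rmulBr rmulNr].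
by apply: key => //; exact: sums_productsN.
Qed.

Lemma covers_right : covers (module_bound * (module_bound * K)) X
  (fun z => exists m a, [/\ m \in M, a \in X & z = m ** a]).
Proof.
have c1 := sum2 (sum2 PP PP) covers_triple.
have key a w : a \in X -> w \in sums_products X ->
    sumP (sumP PX PX) (fun z => exists x y w, [/\ x \in X, y \in X, w \in X & z = x ** y ** w]) (w ** a).
  move=> aX /sums_productsP[x [y [c [d [xX yX cX dX ->]]]]].
  exists (x ** a + y ** a), (c ** d ** a); split.
  - by exists (x ** a), (y ** a); split=> //; [exists x, a | exists y, a].
  - by exists c, d, a.
  - by rewrite !rmulDl.
apply: covers_sub (sum2 c1 c1) => z [m [a [/bohr_ambientP[w [w' [ws ws' ->]]] aX ->]]].
exists (w ** a), ((- w') ** a); split; [exact: key | | by rewrite rmulBl rmulNl].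
by apply: key => //; exact: sums_productsN.
Qed.

Lemma sumset_card (RR : realType) : #|` sumset X X|%:R <= K%:R * #|` X|%:R :> RR.
Proof.
rewrite -natrM ler_nat; apply: covers_card; apply: covers_sub XX => x /sumsetP[y [z [yX zX ->]]].
by exists y, z.
Qed.

End ProductCovers.

(** * Covering X by balls of the norm *)

Section BallColoring.
Local Open Scope fset_scope.
Local Open Scope ring_scope.
Variable RR : realType.

(** Translates of X enlarge the colored set to [D] by [colored_covered] and the test set to [D'] by
    [colored_extend]. *)
Lemma left_translates_colored_covered (K e d : RR) (k : nat) : 1 <= K -> 0 < e -> 0 < d ->
  exists n, forall (R : rngType) (X : {fset R}) (t : R -> RR) (D D' : R -> Prop), 0 \in X ->
    #|` sumset X X|%:R <= K * #|` X|%:R -> is_mod1 t ->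
    e * #|` X|%:R ^+ 2 <= `|csum t (products X)| -> covers k X D -> covers k X D' ->
    colored n D (fun a b => forall x, D' x -> nrm (t ((a - b) ** x)) <= d).
Proof.
move=> K1 e0 d0; have d20 : 0 < d / 2 by lra.
have [n0 left] := left_translates_colored K1 e0 d20.
have [m m0 ext] := colored_extend d20.
exists (k * (n0 * m ^ k))%N => R X t D D' X0 XX tD big covD [tr trk trP].
have nrmB u v y : nrm (t (u ** y) - t (v ** y)) = nrm (t ((u - v) ** y)).
  by rewrite rmulBl (nrm_mod1B tD).
have col : colored n0 (fun a => a \in X)
    (fun a b => forall x, x \in X -> nrm (t (a ** x) - t (b ** x)) <= d / 2).
  by apply: colored_sub (left R X t X0 XX tD big) => // a b _ _ h x /h; rewrite nrmB.
have col2 := ext R R (fun a => a \in X) (fun a x => t (a ** x)) n0 (fun x => x \in X) D' tr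
   (fun a _ => is_mod1_mull a tD) col trP.
have le : (n0 * m ^ size tr <= n0 * m ^ k)%N by rewrite leq_mul2l leq_pexp2l ?orbT.
apply: (colored_covered covD (colored_le le col2)) => x y s xs ys h z /h.
rewrite nrmB opprB addrA subrK => /le_trans; apply.
by rewrite mulr2n; lra.
Qed.

(* A net of the spectrum leaves boundedly many [t]; for [t (m ** _)], total boundedness of
   the family indexed by [m] leaves boundedly many [m]. *)
Lemma bohr_ball_colored (K : nat) (e d : RR) : (0 < K)%N -> 0 < e -> 0 < d ->
  exists n, forall (R : rngType) (X : {fset R}), approx_fset K X ->
  colored n (fun a => a \in X) (fun a b => forall t, is_mod1 t ->
    e * #|` X|%:R <= `|csum t X| -> e * #|` X|%:R ^+ 2 <= `|csum t (products X)| ->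
    nrm (t (a - b)) <= d /\ forall m, m \in bohr_ambient X ->
      nrm (t ((a - b) ** m)) <= d /\ nrm (t (m ** (a - b))) <= d).
Proof.
move=> K0 e0 d0; have K1 : 1 <= K%:R :> RR by rewrite ler1n.
have d20 : 0 < d / 2 by lra.
have d40 : 0 < d / 4 by lra.
have d80 : 0 < d / 8 by lra.
pose kM := maxn 1 (K * (K * K) * (K * (K * K) * K)).
pose kD := (1 + (module_bound K * (module_bound K * K) + module_bound K * (module_bound K * K)))%N.
have [n1 spec] := spectrum_colored K1 e0 d80.
have [m1 m10 ext] := colored_extend d80.
have [n2 left2] := left_translates_colored_covered kM K1 e0 d20.
have [n3 left3] := left_translates_colored_covered kM K1 e0 d80.
have [v2 v20 val2] := colored_value d20.
have [v4 v40 val4] := colored_value d40.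
pose nspec := (n1 * m1 ^ kD)%N.
pose ncol := (v2 * (n2 * v4 ^ n3))%N.
(* [maxn 1] keeps the base positive, so that the power grows with the exponent when the net has
   fewer than [nspec] members. *)
exists (maxn 1 ncol ^ nspec)%N => R X apX.
have [X0 XN _ _] := apX; have XX := sumset_card apX RR.
set M := bohr_ambient X.
(* The net of the spectrum has to be accurate on X, X M and M X, where the twists are evaluated at
   [a] and [b]. *)
pose D z := z \in X \/ (exists a m, [/\ a \in X, m \in M & z = a ** m]) \/
  (exists m a, [/\ m \in M, a \in X & z = m ** a]).
have covD : covers kD X D := covers_or (covers_self X) (covers_or (covers_left apX) (covers_right apX)).
have covM : covers kM X (fun m => m \in M) := covers_le (leq_maxr _ _) (covers_bohr_ambient apX).
have covX : covers kM X (fun x => x \in X) := covers_le (leq_maxl _ _) (covers_self X).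
pose P (t : R -> RR) := [/\ is_mod1 t, e * #|` X|%:R <= `|csum t X| &
  e * #|` X|%:R ^+ 2 <= `|csum t (products X)|].
have [ns [r [nsle rP rcov]]] : exists ns (r : 'I_ns -> R -> RR), [/\ (ns <= nspec)%N,
    forall i, P (r i) & forall t, P t -> exists i, forall z, D z -> nrm (t z - r i z) <= d / 4].
  have [tr trk trP] := covD.
  have col : colored n1 P (fun t u => forall x, x \in X -> nrm (t x - u x) <= d / 8).
    by apply: colored_sub (spec R X X0 XX) => // t [].
  have PD t : P t -> is_mod1 t by case.
  have [ns [r [nsle rP rcov]]] := colored_net (ext R _ P id n1 _ D tr PD col trP).
  exists ns, r; split=> //.
    by apply: leq_trans nsle _; rewrite leq_mul2l leq_pexp2l ?orbT.
  move=> t /rcov[i h]; exists i => z /h/le_trans; apply; rewrite mulr2n; lra.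
have colr i : colored (maxn 1 ncol) (fun a => a \in X) (fun a b =>
    nrm (r i (a - b)) <= d / 2 /\ forall m, m \in M ->
      nrm (r i ((a - b) ** m)) <= d / 2 /\ nrm (r i (m ** (a - b))) <= d / 2).
  have [rD r1 r2] := rP i.
  apply: colored_le (leq_maxr _ _) _.
  have [np [q [npn qM qcov]]] := colored_net (left3 R X (r i) _ _ X0 XX rD r2 covM covX).
  have colq := colored_all (fun k : 'I_np => val4 R (fun a => a \in X) (fun a => r i (q k ** a))).
  have leq3 : (v4 ^ #|'I_np| <= v4 ^ n3)%N by rewrite card_ord leq_pexp2l.
  apply: colored_sub (colored_and (val2 R (fun a => a \in X) (r i))
    (colored_and (left2 R X (r i) _ _ X0 XX rD r2 covX covM) (colored_le leq3 colq))) => //.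
  move=> a b aX bX [h1 [h2 h3]]; split; first by rewrite (nrm_mod1B rD).
  move=> m mM; split; first exact: h2.
  have [k hk] := qcov m mM.
  (* Only boundedly many characters r i (q k ** _) need to be colored: [m] is replaced by a [q k]
     near it, at the cost of d / 8 at each of [a] and [b]. *)
  have -> : m ** (a - b) = q k ** (a - b) + ((m - q k) ** a - (m - q k) ** b).
    by rewrite -rmulBr -rmulDl [q k + _]addrC subrK.
  apply: le_trans (nrm_mod1D_le rD _ _) _.
  have := nrm_mod1B_le rD ((m - q k) ** a) ((m - q k) ** b).
  have hqk : nrm (r i (q k ** (a - b))) <= d / 4 by rewrite rmulBr (nrm_mod1B rD) h3.
  by have := hk a aX; have := hk b bX; move: hqk; lra.
have le : ((maxn 1 ncol) ^ #|'I_ns| <= (maxn 1 ncol) ^ nspec)%N.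
  by rewrite card_ord leq_pexp2l // leq_maxl.
apply: colored_sub (colored_le le (colored_all colr)) => // a b aX bX h t tD t1 t2.
have [i hi] := rcov t (And3 tD t1 t2).
have [rD _ _] := rP i.
(* The budget is d / 2 for [r i], and d / 4 at each of [x] and [y] for passing from [t] to [r i]. *)
have comb x y : D x -> D y -> nrm (r i (x - y)) <= d / 2 -> nrm (t (x - y)) <= d.
  move=> /hi hx /hi hy; rewrite (nrm_mod1B rD) (nrm_mod1B tD) => hr.
  have -> : t x - t y = (r i x - r i y) + ((t x - r i x) - (t y - r i y)) by ring.
  apply: le_trans (nrmD _ _) _; have := nrmB (t x - r i x) (t y - r i y); lra.
have [h1 h2] := h i; split; first by apply: comb => //; left.
move=> m mM; have [h3 h4] := h2 m mM; split.
  rewrite rmulBl; apply: comb; last by rewrite -rmulBl.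
    by right; left; exists a, m.
  by right; left; exists b, m.
rewrite rmulBr; apply: comb; last by rewrite -rmulBr.
  by right; right; exists m, a.
by right; right; exists m, b.
Qed.

End BallColoring.

(** * The structure theorem *)

Section BohrNorm.
Local Open Scope fset_scope.
Local Open Scope ring_scope.
Variables (RR : realType) (R : rngType) (K : nat) (X : {fset R}) (I : finType) (g : I -> R -> RR).
Hypothesis apX : approx_fset K X.
Hypothesis K0 : (0 < K)%N.
Hypothesis I0 : (0 < #|I|)%N.
Hypothesis gD : forall i, is_mod1 (g i).

Local Notation M := (bohr_ambient X).

(** Bogolyubov's argument is applied at sums and products of elements of M, to obtain local closure
    of M; the point 0 serves Parseval and the energy bound. *)
Definition test_points : seq R :=
  0 :: [seq x + y | x <- M, y <- M] ++ [seq x ** y | x <- M, y <- M].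
Hypothesis orth : forall q, q \in [seq w - y | w <- M, y <- test_points] -> q != 0 ->
  \sum_i cos1 (g i q) = 0.

(** As |2X + XX| <= K^3 |X|, the positivity argument asks for 3 e^2 K^3 < 1; this value gives 3 / (4
    K). *)
Definition spectrum_cutoff : RR := (2 * K%:R ^+ 2)^-1.

Definition in_spectrum i := (spectrum_cutoff * #|` X|%:R <= `|csum (g i) X|) &&
  (spectrum_cutoff * #|` X|%:R ^+ 2 <= `|csum (g i) (products X)|).

(** [None] keeps the character, [true] and [false] precompose it with right and left multiplication
    by [m]. All of M is used, so a small N(x) bounds the spectrum on every xm and mx; for x in M
    this puts the products into M. *)
Definition twist (j : I * option (bool * M)) : R -> RR :=
  match j.2 with
  | None => g j.1
  | Some (true, m) => fun x => g j.1 (x ** val m)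
  | Some (false, m) => fun x => g j.1 (val m ** x)
  end.

Definition bohr_norm x : RR := \big[Num.max/0]_(j | in_spectrum j.1) nrm (twist j x).

Lemma twist_mod1 j : is_mod1 (twist j).
Proof.
case: j => i [[[] m]|]; rewrite /twist /=; last exact: gD.
  exact: is_mod1_mulr (gD i).
exact: is_mod1_mull (gD i).
Qed.

Lemma nrm_bohr_norm j x : in_spectrum j.1 -> nrm (twist j x) <= bohr_norm x.
Proof. by move=> sj; rewrite /bohr_norm (bigD1 j) //= le_max lexx. Qed.

Lemma bohr_norm_le x c : 0 <= c -> (forall j, in_spectrum j.1 -> nrm (twist j x) <= c) ->
  bohr_norm x <= c.
Proof.
move=> c0 h; rewrite /bohr_norm; elim/big_ind: _ => // a b ha hb.
by rewrite ge_max ha.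
Qed.

Lemma bohr_norm_ge0 x : 0 <= bohr_norm x.
Proof. by rewrite /bohr_norm; elim/big_rec: _ => // j a _ a0; rewrite le_max a0 orbT. Qed.

Lemma bohr_norm0 : bohr_norm 0 = 0.
Proof.
apply/le_anti; rewrite bohr_norm_ge0 andbT; apply: bohr_norm_le => // j _.
by rewrite (nrm_mod1_0 (twist_mod1 j)).
Qed.

Lemma bohr_normD x y : bohr_norm (x + y) <= bohr_norm x + bohr_norm y.
Proof.
apply: bohr_norm_le => [|j sj]; first by rewrite addr_ge0 ?bohr_norm_ge0.
apply: le_trans (nrm_mod1D_le (twist_mod1 j) _ _) _.
by apply: lerD; exact: nrm_bohr_norm.
Qed.

Lemma bohr_normN x : bohr_norm (- x) = bohr_norm x.
Proof. by apply: eq_bigr => j _; rewrite (nrm_mod1N (twist_mod1 j)). Qed.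

Lemma bohr_norm_double x : bohr_norm x <= 4^-1 -> bohr_norm (x *+ 2) = bohr_norm x *+ 2.
Proof.
move=> h; apply/le_anti/andP; split; first by rewrite !mulr2n; exact: bohr_normD.
suff : bohr_norm x <= bohr_norm (x *+ 2) / 2 by rewrite mulr2n; lra.
apply: bohr_norm_le => [|j sj]; first by rewrite divr_ge0 ?bohr_norm_ge0.
have := nrm_bohr_norm (x *+ 2) sj; rewrite mulr2n (nrm_mod1D (twist_mod1 j)) -mulr2n nrm_double.
  by rewrite mulr2n; lra.
exact: le_trans (nrm_bohr_norm x sj) h.
Qed.

Lemma cutoff_gt0 : 0 < spectrum_cutoff.
Proof. by rewrite invr_gt0 mulr_gt0 // exprn_gt0 // ltr0n. Qed.

Lemma spectrum_ball_ambient x : x \in test_points ->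
  (forall i, in_spectrum i -> nrm (g i x) <= 8^-1) -> x \in M.
Proof.
move=> xQ h; apply/bohr_ambientP.
have [X0 XN _ _] := apX.
have K1 : 1 <= K%:R :> RR by rewrite ler1n.
pose U : {fset R} := [fset w in sums_products X].
have Uw w : (w \in U) = (w \in sums_products X) by rewrite inE.
apply: (@bohr_sums_products RR R X XN X0 I g U (K%:R ^+ 3) spectrum_cutoff x) => //.
- exact: ltW cutoff_gt0.
- have -> : 3 * spectrum_cutoff ^+ 2 * K%:R ^+ 3 = 3 / (4 * K%:R).
    by rewrite /spectrum_cutoff; field; rewrite pnatr_eq0 -lt0n.
  by rewrite ltr_pdivrMr; lra.
- by move=> w; rewrite Uw.
- rewrite -natrX -natrM ler_nat; apply: (@leq_trans (K * (K * K) * #|` X|)); last first.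
    by rewrite !expnS expn0 muln1.
  by apply: covers_card; apply: covers_sub (covers_sums_products apX) => w; rewrite Uw.
- move=> w w' y ws ws' yx; apply: orth; apply/allpairsP; exists (w - w', y); split=> //=.
    by apply/bohr_ambientP; exists w, w'.
  by case: yx => -> //; exact: mem_head.
- by move=> i h1 h2; apply: h; rewrite /in_spectrum h1.
Qed.

Lemma test_sum x y : x \in M -> y \in M -> x + y \in test_points.
Proof.
move=> xM yM; rewrite inE mem_cat; apply/orP; right; apply/orP; left.
by apply/allpairsP; exists (x, y).
Qed.

Lemma test_prod x y : x \in M -> y \in M -> x ** y \in test_points.
Proof.
move=> xM yM; rewrite inE mem_cat; apply/orP; right; apply/orP; right.
by apply/allpairsP; exists (x, y).
Qed.

Lemma bohr_norm_ambient x y : x \in M -> y \in M -> bohr_norm (x + y) <= 8^-1 -> x + y \in M.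
Proof.
move=> xM yM h; apply: spectrum_ball_ambient; first exact: test_sum.
by move=> i si; apply: le_trans h; exact: (@nrm_bohr_norm (i, None)).
Qed.

Lemma nrm_mulr_bohr_norm x m i : m \in M -> in_spectrum i -> nrm (g i (x ** m)) <= bohr_norm x.
Proof. by move=> mM si; exact: (@nrm_bohr_norm (i, Some (true, [` mM])) x si). Qed.

Lemma nrm_mull_bohr_norm x m i : m \in M -> in_spectrum i -> nrm (g i (m ** x)) <= bohr_norm x.
Proof. by move=> mM si; exact: (@nrm_bohr_norm (i, Some (false, [` mM])) x si). Qed.

(** Associativity moves the twist into one factor: t((xy)m) = t(x(ym)) is bounded by N(x), since ym
    is in M for small y, and t(m(xy)) = t((mx)y) is bounded by N(y), since mx is in M for small
    x. *)
Lemma bohr_norm_mul x y : x \in M -> y \in M -> bohr_norm x <= 8^-1 -> bohr_norm y <= 8^-1 ->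
  x ** y \in M /\ bohr_norm (x ** y) <= 8^-1.
Proof.
move=> xM yM hx hy.
have inM a m : a \in M -> m \in M -> bohr_norm a <= 8^-1 -> a ** m \in M /\ m ** a \in M.
  move=> aM mM ha; split; apply: spectrum_ball_ambient; try exact: test_prod.
    by move=> i si; apply: le_trans ha; exact: nrm_mulr_bohr_norm.
  by move=> i si; apply: le_trans ha; exact: nrm_mull_bohr_norm.
split; first exact: (inM x y xM yM hx).1.
apply: bohr_norm_le => [|[i [[[] m]|]] si]; first by rewrite invr_ge0.
- rewrite /twist /= -rmulA; apply: le_trans hx.
  by apply: nrm_mulr_bohr_norm => //; exact: (inM y (val m) yM (valP m) hy).1.
- rewrite /twist /= rmulA; apply: le_trans hy.
  by apply: nrm_mull_bohr_norm => //; exact: (inM x (val m) xM (valP m) hx).2.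
- by apply: le_trans hx; exact: nrm_mulr_bohr_norm.
Qed.

End BohrNorm.

Lemma approx_fset_structure (K : nat) : (0 < K)%N -> exists C : nat,
  forall (R : rngType) (X : {fset R}), approx_fset K X ->
  exists (R' : subrng R) (I : rngIdeal (subrng_type R')),
    [/\ exists2 s : seq R, (size s <= C)%N &
          forall x, x \in X -> exists2 t, t \in s & x - t \in (R' : {pred R}),
        forall u, u \in (I : {pred subrng_type R'}) -> val u \in bohr_ambient X
      & nilpotent_class_le (rng_quot I) C].
Proof.
move=> K0; pose RR : realType := Rdefinitions.R.
pose e : RR := spectrum_cutoff RR K.
pose d : RR := 8^-1.
have d0 : 0 < d by rewrite invr_gt0.
have e0 : 0 < e by exact: cutoff_gt0.
have d160 : 0 < d / 16 by rewrite divr_gt0.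
have [n ball] := bohr_ball_colored K0 e0 d160.
pose kM := maxn 1 (K * (K * K) * (K * (K * K) * K)).
(* One more than the number of colors of M, for the pigeonhole principle; fixed before the ring and
   the family of characters. *)
pose C := (kM * n).+1.
exists C => R X apX; have [X0 XN _ _] := apX.
have [I [g [I0 gD orth]]] := char_family RR [seq w - y | w <- bohr_ambient X, y <- test_points X].
pose N := @bohr_norm RR R K X I g.
have ball' : colored n (fun a => a \in X) (fun a b => N (a - b) <= d / 16).
  apply: colored_sub (ball R X apX) => // a b _ _ h.
  apply: bohr_norm_le => [|[i o] /= /andP[s1 s2]]; first exact: ltW.
  have [h1 h2] := h (g i) (gD i) s1 s2.
  case: o => [[[] m]|] //; first exact: (h2 _ (valP m)).1.
  exact: (h2 _ (valP m)).2.
have covM : covers kM X (fun m => m \in bohr_ambient X) :=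
  covers_le (leq_maxr _ _) (covers_bohr_ambient apX).
have colM : colored (kM * n) (fun m => m \in bohr_ambient X) (fun x y => N (x - y) <= d / 16).
  apply: (colored_covered covM ball') => x y t _ _.
  by rewrite opprB addrA subrK.
have packM (f : 'I_C -> R) (fM : forall i, f i \in bohr_ambient X) := colored_pigeon colM fM.
have [] := @nilpotent_structure RR R (bohr_ambient X) N d d C; rewrite ?lexx //.
- exact: bohr_norm0.
- exact: bohr_norm_ge0.
- exact: bohr_normN.
- exact: bohr_normD.
- exact: bohr_norm_double.
- exact: (bohr_ambient0 apX).
- exact: bohr_ambientN.
- by move=> x y xM yM; apply: (bohr_norm_ambient apX K0 I0 gD orth).
- by move=> x y xM yM; apply: (bohr_norm_mul apX K0 I0 gD orth).
move=> R' [J [small JM nil]]; exists R', J; split=> //.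
have [m [r [mn rX rcov]]] := colored_net ball'.
exists [seq r i | i <- enum 'I_m].
  rewrite size_map size_enum_ord; apply: leq_trans mn _.
  by apply: leqW; rewrite leq_pmull // leq_maxl.
move=> x xX; have [i hi] := rcov x xX; exists (r i).
  by apply: map_f; rewrite mem_enum.
(* Differences of elements of X lie in M, and d / 16 is below the radius d / 4 of the small
   elements, all of which are in [R']. *)
apply: small; split; first exact: (bohr_ambientB apX).
by apply: le_trans hi _; move: d0; lra.
Qed.

(** * The iterates of X, and the passage from sets to finite sets *)

Section Iterates.
Variables (R : rngType) (X : set R).
Hypothesis X0 : X 0.
Hypothesis XN : forall x, X x -> X (- x).

Lemma approx_iter0 n : approx_iter X n 0.
Proof.
elim: n => //= n IH; exists 0; first by exists 0 => //; exists 0; rewrite ?addr0.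
by exists 0; rewrite ?addr0 //; exists 0 => //; exists 0; rewrite ?rmul0r.
Qed.

Lemma approx_iterD n x y : approx_iter X n x -> approx_iter X n y -> approx_iter X n.+1 (x + y).
Proof.
move=> hx hy; exists (x + y); first by exists x => //; exists y.
exists 0; rewrite ?addr0 //; exists 0; first exact: approx_iter0.
by exists 0; rewrite ?rmul0r //; exact: approx_iter0.
Qed.

Lemma approx_iterS n x : approx_iter X n x -> approx_iter X n.+1 x.
Proof. by move=> h; rewrite -[x]addr0; apply: approx_iterD => //; exact: approx_iter0. Qed.

End Iterates.

Theorem theorem1p2 : forall K : nat, exists C : nat,
  forall (R : rngType) (X : set R),
    finite_set X -> approximate_subring K X ->
    exists (R' : subrng R) (I : rngIdeal (subrng_type R')),
      [/\ covered_by_translates C X [set x : R | x \in (R' : {pred R})],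
          [set val u | u in [set u | u \in (I : {pred subrng_type R'})]]
            `<=` approx_iter X 3
        & nilpotent_class_le (rng_quot I) C].
Proof.
case=> [|K].
  (* For K = 0 there is no such X: the element 0 + 0 of X + X would have to be covered by no
     translates. *)
  exists 0%N => R X _ [[X0 _] [s]]; rewrite leqn0 size_eq0 => /eqP ->.
  move=> /(_ 0); case=> [|x //].
  by right; exists 0 => //; exists 0; rewrite ?addr0.
have [C hC] := @approx_fset_structure K.+1 isT.
exists C => R X finX [[X0 XsymE] [F FK FP]].
have XN x : X x -> X (- x) by move=> Xx; rewrite XsymE; exists x.
pose Y := fset_set X.
have YX x : (x \in Y) <-> X x.
  by rewrite in_fset_set //; split; [exact: set_mem | exact: mem_set].
have apY : approx_fset K.+1 Y.
  have cov z : (setmul X X `|` setadd X X)%classic z -> exists2 t, t \in F & z - t \in Y.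
    by move=> /FP[t /= tF [x Xx <-]]; exists t => //; rewrite addrC addKr; exact/YX.
  split=> [|x /YX Xx||]; [exact/YX | exact/YX/XN | |]; exists F => // z [x [y [/YX Xx /YX Yy ->]]].
    by apply: cov; right; exists x => //; exists y.
  by apply: cov; left; exists x => //; exists y.
have [R' [I [[s sC sP] IM nil]]] := hC R Y apY.
exists R', I; split=> //.
  exists s => // x /YX/sP[t ts xt]; exists t => //; exists (x - t) => //.
  by rewrite addrC subrK.
move=> _ [u /= uI <-].
have /bohr_ambientP[w [w' [ws ws' ->]]] := IM u uI.
have inX1 v : v \in sums_products Y -> approx_iter X 1 v.
  move=> /sums_productsP[x [y [a [b [/YX Xx /YX Xy /YX Xa /YX Xb ->]]]]].
  exists (x + y); first by exists x => //; exists y.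
  by exists (a ** b) => //; exists a => //; exists b.
suff : approx_iter X 3 (w - w') by [].
(* Both w and -w' are in X_1, so their sum is already in X_2. *)
apply: approx_iterS => //; apply: approx_iterD => //; first exact: inX1.
by apply: inX1; exact: (sums_productsN apY).
Qed.
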